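(* Let $\Phi:\mathbb{U}\to\mathbb{C}$ be a biholomorphic function onto its image with $\Phi(0)=1$, $\operatorname{Re}\Phi(z)>0$ on $\mathbb{U}$, $\Phi'(0)>0$, $\Phi''(0)\in\mathbb{R}$, and suppose that $$|\Phi''(0)+2(\Phi'(0))^2|\ge 2\Phi'(0)>0 .$$ Let $g(z)=z+b_2z^2+b_3z^3+\cdots$ be holomorphic in $\mathbb{U}$ with $g/g'\in\mathcal{M}_\Phi$. Then $$|\det T_{2,2}(g)|\le \frac{(\Phi'(0))^2}{4}\left(\frac12\frac{\Phi''(0)}{\Phi'(0)}+\Phi'(0)\right)^2+(\Phi'(0))^2 .$$ The bound is sharp, i.e. for each such $\Phi$ equality holds for some such $g$.
   Context: $\mathbb{U}=\{z\in\mathbb{C}:|z|<1\}$. For $g(z)=z+\sum_{n\ge2}b_nz^n$, $\det T_{2,2}(g)=b_2^2-b_3^2$ (the determinant of the $2\times2$ Toeplitz matrix with rows $(b_2,b_3)$, $(b_3,b_2)$). In one variable, $\mathcal{M}_\Phi$ is the class of holomorphic $p:\mathbb{U}\to\mathbb{C}$ with $p(0)=0$, $p'(0)=1$ and $z/p(z)\in\Phi(\mathbb{U})$ for all $z\in\mathbb{U}$ (the quotient taking the value $1$ at $z=0$). Thus $g/g'\in\mathcal{M}_\Phi$ means $zg'(z)/g(z)\in\Phi(\mathbb{U})$ for all $z\in\mathbb{U}$. *)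

(* Defs.v *)
From Stdlib Require Export Reals.
From Coquelicot Require Export Coquelicot.

Open Scope R_scope.
Open Scope C_scope.

Definition unit_disc (z : C) : Prop := (Cmod z < 1)%R.

Definition image (f : C -> C) (D : C -> Prop) (w : C) : Prop :=
  exists z : C, D z /\ f z = w.

(* Complex differentiability at every point; only used for open [D], so the
   values taken by the total function [f] outside [D] are irrelevant. *)
Definition holomorphic_on (D : C -> Prop) (f : C -> C) : Prop :=
  forall z : C, D z -> @ex_derive C_AbsRing C_NormedModule f z.

Definition biholomorphic_onto_image (D : C -> Prop) (f : C -> C) : Prop :=
  holomorphic_on D f /\
  open (image f D) /\
  exists h : C -> C,
    holomorphic_on (image f D) h /\ forall z : C, D z -> h (f z) = z.

(* z / p(z), with its limit value 1 at the origin (p(0) = 0, p'(0) = 1). *)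
Definition id_quotient (p : C -> C) (z : C) : C :=
  if Ceq_dec z 0 then 1 else z / p z.

(* [p z <> 0] off the origin is what makes z / p(z) meaningful; it has to be
   explicit since division is total. *)
Definition class_M (Phi : C -> C) (p : C -> C) : Prop :=
  holomorphic_on unit_disc p /\
  p 0 = 0 /\
  C_derive p 0 = 1 /\
  (forall z : C, unit_disc z -> z <> 0 -> p z <> 0) /\
  (forall z : C, unit_disc z -> image Phi unit_disc (id_quotient p z)).

(* g / g'.  A zero z0 of g' would give the junk value 0 here; [class_M] excludes
   it for z0 <> 0, and g'(0) = 1 for the functions g considered. *)
Definition over_derivative (g : C -> C) (z : C) : C := g z / C_derive g z.

(* g is holomorphic in the disc with g(z) = z + b_2 z^2 + b_3 z^3 + ... there. *)
Definition normalized_expansion (g : C -> C) (b : nat -> C) : Prop :=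
  holomorphic_on unit_disc g /\
  b 0%nat = 0 /\
  b 1%nat = 1 /\
  (forall z : C, unit_disc z ->
     @is_pseries C_AbsRing C_NormedModule b z (g z)).

Definition det2 (a11 a12 a21 a22 : C) : C := a11 * a22 - a12 * a21.

Definition detT22 (b : nat -> C) : C :=
  det2 (b 2%nat) (b 3%nat)
       (b 3%nat) (b 2%nat).

(* Main.v *)
Require Import Defs.
From Stdlib Require Import Reals Lra Lia Psatz ClassicalEpsilon.
From Coquelicot Require Import Coquelicot.

(* Write z g'/g = Phi(w) with w = Phi^-1(z g'/g), a holomorphic self-map of the
   disc fixing 0, w = c1 z + c2 z^2 + ...  Comparing coefficients gives
   b2 = d1 c1 and 4 b3 = (d2 + 2 d1^2) c1^2 + 2 d1 c2.  The Schwarz-type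
   inequality |c2| <= 1 - |c1|^2 and |d2 + 2 d1^2| >= 2 d1 then yield
   4 |b3| <= |d2 + 2 d1^2|, and |b2^2 - b3^2| <= |b2|^2 + |b3|^2.  Equality holds
   for w = i z, that is g = z exp L with z L' = Phi(i z) - 1, since b2^2 < 0 < b3^2.

   Taylor expansions of merely complex differentiable functions come from
   Goursat's theorem on rectangles, applied in the logarithmic coordinate
   z = e^(s + i t): circles become vertical segments, and the horizontal sides of
   a rectangle of height 2 pi cancel by periodicity. *)

Open Scope R_scope.

(** Write E = d2 + 2 d1^2. The estimate 4 |b3| <= |E| |c1|^2 + 2 d1 (1 - |c1|^2) is affine in
    |c1|^2, and |E| >= 2 d1 puts its maximum at |c1| = 1, where |b2| = d1 |c1| is largest too. Hence
    |b2| and |b3| can be bounded separately without loss. The triangle inequality loses nothing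
    either once b2^2 and b3^2 have opposite signs: as d1 and d2 are real, the rotation by i makes b2
    purely imaginary and keeps b3 real.

    The analytic obstacle is that holomorphy means only that a derivative exists at each point,
    whereas the comparison of coefficients differentiates Phi and w twice. Taylor series supply the
    missing regularity. The Cauchy formula behind them is Goursat's theorem for the difference
    quotient of f at a, which is continuous at a but not yet known to be differentiable there; so
    Goursat's theorem is also needed with one exceptional point. *)

Notation cderiv := (@is_derive C_AbsRing C_NormedModule).
Notation ccont := (@continuous C_UniformSpace C_UniformSpace).
Notation rcont := (@continuous R_UniformSpace C_UniformSpace).
Notation CInt := (@RInt C_R_CompleteNormedModule).
Notation ex_CInt := (@ex_RInt C_R_NormedModule).
Notation is_CInt := (@is_RInt C_R_NormedModule).
Notation cdiff := (@ex_derive C_AbsRing C_NormedModule).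
Notation csum := (sum_n (G := C_AbelianMonoid)).
Notation is_cpseries := (@is_pseries C_AbsRing C_NormedModule).

(* [ring] and [field] need the carrier of an equation to be syntactically [C], not
   the sort of one of its canonical structures. *)
Ltac in_C := match goal with |- ?a = ?b => change (@eq C a b) end.

(** * Complex derivatives and the exponential *)


Lemma cderiv_iff (f : C -> C) (z l : C) :
  cderiv f z l <->
  forall eps : R, 0 < eps -> exists d : R, 0 < d /\
    forall y : C, Cmod (y - z) < d ->
      Cmod (f y - f z - (y - z) * l) <= eps * Cmod (y - z).
Proof.
split.
- intros [_ H] eps He.
  destruct (H z (fun P HP => HP) (mkposreal eps He)) as [d Hd].
  exists d; split; [apply cond_pos | intros y Hy].
  exact (Hd y Hy).
- intros H; split; [apply (@is_linear_scal_l C_AbsRing C_NormedModule)|].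
  intros x Hx.
  assert (Hzx : z = x)
    by (apply (@is_filter_lim_locally_unique C_AbsRing (AbsRing_NormedModule C_AbsRing)); exact Hx).
  rewrite <- Hzx.
  intros eps. destruct (H eps (cond_pos eps)) as [d [Hd1 Hd]].
  exists (mkposreal d Hd1); intros y Hy. exact (Hd y Hy).
Qed.

Lemma ccont_iff (f : C -> C) (z : C) :
  ccont f z <->
  forall eps : R, 0 < eps -> exists d : R, 0 < d /\
    forall y : C, Cmod (y - z) < d -> Cmod (f y - f z) < eps.
Proof.
split.
- intros H eps He.
  assert (L : locally (T := C_UniformSpace) (f z) (fun w => Cmod (w - f z) < eps)).
  { apply locally_C. exists (mkposreal eps He). intros w Hw; exact Hw. }
  generalize (H _ L); intros L'. apply locally_C in L'.
  destruct L' as [d Hd]; exists d; split; [apply cond_pos|].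
  intros y Hy; exact (Hd y Hy).
- intros H P HP. apply locally_C in HP. destruct HP as [e He].
  destruct (H e (cond_pos e)) as [d [Hd1 Hd]].
  apply locally_C. exists (mkposreal d Hd1). intros y Hy. apply He, Hd, Hy.
Qed.

Lemma cderiv_cont (f : C -> C) (z l : C) : cderiv f z l -> ccont f z.
Proof.
intros H. apply ccont_iff. intros eps He.
destruct (proj1 (cderiv_iff _ _ _) H 1 Rlt_0_1) as [d [Hd H1]].
set (M := Cmod l + 1).
assert (HM : 0 < M) by (unfold M; generalize (Cmod_ge_0 l); lra).
exists (Rmin d (eps / M)). split.
  apply Rmin_pos; [lra | now apply Rdiv_lt_0_compat].
intros y Hy.
assert (Hy1 : Cmod (y - z) < d) by (eapply Rlt_le_trans; [exact Hy | apply Rmin_l]).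
assert (Hy2 : Cmod (y - z) < eps / M) by (eapply Rlt_le_trans; [exact Hy | apply Rmin_r]).
replace (f y - f z)%C with ((f y - f z - (y - z) * l) + (y - z) * l)%C by ring.
eapply Rle_lt_trans; [apply Cmod_triangle|]. rewrite Cmod_mult.
specialize (H1 y Hy1).
apply Rle_lt_trans with (Cmod (y - z) * M); [unfold M; nra|].
apply Rmult_lt_compat_r with (r := M) in Hy2; [|lra].
unfold Rdiv in Hy2; rewrite Rmult_assoc, Rinv_l in Hy2; lra.
Qed.

Lemma cderiv_unique (f : C -> C) (z l1 l2 : C) : cderiv f z l1 -> cderiv f z l2 -> l1 = l2.
Proof.
intros H1 H2.
now rewrite <- (is_C_derive_unique _ _ _ H1), <- (is_C_derive_unique _ _ _ H2).
Qed.

Lemma cderiv_C_derive (f : C -> C) (z : C) : cdiff f z -> cderiv f z (C_derive f z).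
Proof. intros H; now apply C_derive_correct. Qed.

Lemma cderiv_ext_loc (f g : C -> C) (z l : C) (d : R) : 0 < d ->
  (forall y, Cmod (y - z) < d -> f y = g y) -> cderiv f z l -> cderiv g z l.
Proof.
intros Hd H Hf. apply is_derive_ext_loc with f; [|exact Hf].
exists (mkposreal d Hd). intros y Hy; apply H, Hy.
Qed.

Lemma cderiv_eq (f : C -> C) (z l l' : C) : cderiv f z l -> l = l' -> cderiv f z l'.
Proof. now intros H <-. Qed.

Lemma cderiv_const (a z : C) : cderiv (fun _ => a) z (RtoC 0).
Proof. apply (@is_derive_const C_AbsRing C_NormedModule). Qed.

Lemma cderiv_id (z : C) : cderiv (fun y => y) z (RtoC 1).
Proof.
apply cderiv_iff. intros eps He. exists 1; split; [lra|]. intros y _.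
replace (y - z - (y - z) * 1)%C with (RtoC 0) by ring.
rewrite Cmod_0. apply Rmult_le_pos; [lra | apply Cmod_ge_0].
Qed.

Lemma cderiv_plus (f g : C -> C) (z l m : C) : cderiv f z l -> cderiv g z m ->
  cderiv (fun y => f y + g y)%C z (l + m)%C.
Proof. apply (@is_derive_plus C_AbsRing C_NormedModule). Qed.

Lemma cderiv_minus (f g : C -> C) (z l m : C) : cderiv f z l -> cderiv g z m ->
  cderiv (fun y => f y - g y)%C z (l - m)%C.
Proof. apply (@is_derive_minus C_AbsRing C_NormedModule). Qed.

(** [C] is a normed module over itself through two structures, and the product and chain rules refer
    to the one induced by the absolute ring. The little-o conditions are convertible, so only
    linearity is proved again. *)
Lemma cderiv_abs (f : C -> C) (z l : C) :
  cderiv f z l <-> @is_derive C_AbsRing (AbsRing_NormedModule C_AbsRing) f z l.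
Proof.
split; intros [_ H]; (split; [apply is_linear_scal_l | exact H]).
Qed.

Lemma cderiv_mult (f g : C -> C) (z l m : C) : cderiv f z l -> cderiv g z m ->
  cderiv (fun y => f y * g y)%C z (l * g z + f z * m)%C.
Proof.
intros Hf Hg. apply cderiv_abs.
apply (@is_derive_mult C_AbsRing f g z l m).
- now apply cderiv_abs.
- now apply cderiv_abs.
- intros; apply Cmult_comm.
Qed.

Lemma cderiv_comp (f g : C -> C) (z l m : C) : cderiv f (g z) l -> cderiv g z m ->
  cderiv (fun y => f (g y)) z (m * l)%C.
Proof.
intros Hf Hg. apply (@is_derive_comp C_AbsRing C_NormedModule); [exact Hf|].
now apply cderiv_abs.
Qed.

Lemma Cmod_sub_rev (x y : C) : Cmod (x - y) = Cmod (y - x).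
Proof. rewrite <- Cmod_opp. f_equal. ring. Qed.

Lemma Cmod_triangle_sub (x y : C) : Cmod x <= Cmod (x - y) + Cmod y.
Proof. replace x with ((x - y) + y)%C at 1 by ring. apply Cmod_triangle. Qed.

Lemma cderiv_Cinv (z : C) : z <> 0%C -> cderiv Cinv z (- / (z * z))%C.
Proof.
intros Hz. apply cderiv_iff. intros eps He.
assert (Hm : 0 < Cmod z) by now apply Cmod_gt_0.
set (r := Cmod z) in *.
(* The error is (y - z)^2 / (y z^2). The first bound forces |y| > r / 2, hence |y z^2| >= r^3 / 2;
   the second then compensates this denominator. *)
set (d := Rmin (r / 2) (eps * (r ^ 3 / 2))).
assert (Hr3 : 0 < r ^ 3) by now apply pow_lt.
exists d. split.
  unfold d; apply Rmin_pos; [lra | apply Rmult_lt_0_compat; lra].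
intros y Hy.
assert (H1 : Cmod (y - z) < r / 2) by (eapply Rlt_le_trans; [exact Hy | apply Rmin_l]).
assert (H2 : Cmod (y - z) < eps * (r ^ 3 / 2)) by (eapply Rlt_le_trans; [exact Hy | apply Rmin_r]).
assert (Hy2 : r / 2 < Cmod y).
{ generalize (Cmod_triangle_sub z y); rewrite (Cmod_sub_rev z y); fold r; lra. }
assert (Hy0 : y <> 0%C) by (apply Cmod_gt_0; lra).
replace (/ y - / z - (y - z) * - / (z * z))%C with ((y - z) * ((y - z) / (y * (z * z))))%C
  by (field; auto).
rewrite Cmod_mult, Cmod_div, !Cmod_mult by (repeat apply Cmult_neq_0; auto).
fold r. rewrite (Rmult_comm eps). apply Rmult_le_compat_l; [apply Cmod_ge_0|].
assert (Hp : r ^ 3 / 2 <= Cmod y * (r * r)).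
{ simpl. assert (0 < r * r) by now apply Rmult_lt_0_compat. nra. }
apply Rle_div_l; [lra|]. nra.
Qed.

Lemma cderiv_inv (f : C -> C) (z l : C) : cderiv f z l -> f z <> 0%C ->
  cderiv (fun y => / f y)%C z (- l / (f z * f z))%C.
Proof.
intros Hf H0. eapply cderiv_eq; [apply (cderiv_comp Cinv f); [now apply cderiv_Cinv | exact Hf]|].
field; auto.
Qed.

Lemma cderiv_div (f g : C -> C) (z l m : C) : cderiv f z l -> cderiv g z m -> g z <> 0%C ->
  cderiv (fun y => f y / g y)%C z ((l * g z - f z * m) / (g z * g z))%C.
Proof.
intros Hf Hg H0. unfold Cdiv at 1.
eapply cderiv_eq; [apply (cderiv_mult f (fun y => / g y)%C); [exact Hf | apply cderiv_inv; [exact Hg | exact H0]]|].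
field; auto.
Qed.

Lemma cderiv_pow (f : C -> C) (z l : C) (n : nat) : cderiv f z l ->
  cderiv (fun y => f y ^ n)%C z (RtoC (INR n) * f z ^ (pred n) * l)%C.
Proof.
intros Hf. induction n as [|n IH].
- eapply cderiv_eq; [apply (cderiv_const (RtoC 1) z)|]. simpl; ring.
- eapply cderiv_eq.
  + apply (cderiv_mult f (fun y => f y ^ n)%C); [exact Hf | exact IH].
  + rewrite S_INR, RtoC_plus. destruct n as [|n]; simpl; ring.
Qed.

(** * The complex exponential *)

Definition Cexp (z : C) : C := (exp (fst z) * cos (snd z), exp (fst z) * sin (snd z)).

Lemma Cexp_plus x y : Cexp (x + y) = (Cexp x * Cexp y)%C.
Proof.
destruct x as [x1 x2], y as [y1 y2]. unfold Cexp, Cplus, Cmult; simpl.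
rewrite exp_plus, cos_plus, sin_plus. f_equal; ring.
Qed.

Lemma Cexp_0 : Cexp 0 = 1%C.
Proof. unfold Cexp; simpl. rewrite exp_0, cos_0, sin_0. unfold RtoC; f_equal; ring. Qed.

Lemma Cmod_Cexp z : Cmod (Cexp z) = exp (fst z).
Proof.
unfold Cmod, Cexp; simpl fst; simpl snd.
replace ((exp (fst z) * cos (snd z)) ^ 2 + (exp (fst z) * sin (snd z)) ^ 2)%R
  with (exp (fst z) * exp (fst z))%R.
- apply sqrt_square, Rlt_le, exp_pos.
- generalize (sin2_cos2 (snd z)); unfold Rsqr; intros H.
  replace ((exp (fst z) * cos (snd z)) ^ 2 + (exp (fst z) * sin (snd z)) ^ 2)%R
    with (exp (fst z) * exp (fst z) * (sin (snd z) * sin (snd z) + cos (snd z) * cos (snd z)))%R by ring.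
  rewrite H; ring.
Qed.

Lemma Cexp_neq_0 z : Cexp z <> 0%C.
Proof. apply Cmod_gt_0. rewrite Cmod_Cexp. apply exp_pos. Qed.

Lemma Cexp_periodic s t : Cexp (s, t + 2 * PI)%R = Cexp (s, t).
Proof. unfold Cexp; simpl. now rewrite cos_plus, sin_plus, cos_2PI, sin_2PI, !Rmult_0_r, !Rmult_1_r, Rminus_0_r, Rplus_0_r. Qed.

Lemma real_deriv_eps (f : R -> R) (x l : R) : is_derive (K := R_AbsRing) (V := R_NormedModule) f x l ->
  forall eps, 0 < eps -> exists d, 0 < d /\
   forall h, Rabs h < d -> Rabs (f (x + h) - f x - h * l) <= eps * Rabs h.
Proof.
intros [_ H] eps He.
destruct (H x (fun P HP => HP) (mkposreal eps He)) as [d Hd].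
exists d; split; [apply cond_pos | intros h Hh].
specialize (Hd (x + h)). simpl in Hd.
unfold norm, minus, plus, opp, scal, mult in Hd; simpl in Hd.
unfold abs, plus, opp, mult in Hd; simpl in Hd.
replace (f (x + h) - f x - h * l) with (f (x + h) + - f x + - ((x + h + - x) * l)) by ring.
replace h with (x + h + - x) at 3 by ring.
apply Hd. change (Rabs (x + h + - x) < d).
now replace (x + h + - x) with h by ring.
Qed.

Lemma Cmod_le_parts (z : C) : Cmod z <= Rabs (fst z) + Rabs (snd z).
Proof.
destruct z as [x y]; simpl.
replace ((x, y) : C) with (RtoC x + Ci * RtoC y)%C
  by (apply injective_projections; simpl; ring).
eapply Rle_trans; [apply Cmod_triangle|].
rewrite Cmod_mult, !Cmod_R, Cmod_Ci; lra.
Qed.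

Lemma fst_le_Cmod (z : C) : Rabs (fst z) <= Cmod z.
Proof. eapply Rle_trans; [|apply Rmax_Cmod]. apply Rmax_l. Qed.

Lemma snd_le_Cmod (z : C) : Rabs (snd z) <= Cmod z.
Proof. eapply Rle_trans; [|apply Rmax_Cmod]. apply Rmax_r. Qed.

Lemma cderiv_Cexp_0 : cderiv Cexp (RtoC 0) (RtoC 1).
Proof.
apply cderiv_iff. intros eps He.
(* The four error terms below are at most 1, 2, 4 and 1 times e * m, which adds up to 8 e m. The
   bound e <= 1 serves for |1 + x| <= 2 and |sin y| <= 2 m. *)
set (e := Rmin 1 (eps / 8)).
assert (He' : 0 < e) by (apply Rmin_pos; lra).
assert (He1 : e <= 1) by apply Rmin_l.
assert (He2 : e <= eps / 8) by apply Rmin_r.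
destruct (real_deriv_eps exp 0 1 ltac:(rewrite <- exp_0; apply is_derive_exp) e He') as [d1 [Hd1 H1]].
destruct (real_deriv_eps cos 0 0 ltac:(auto_derive; [easy | rewrite sin_0; ring]) e He') as [d2 [Hd2 H2]].
destruct (real_deriv_eps sin 0 1 ltac:(auto_derive; [easy | rewrite cos_0; ring]) e He') as [d3 [Hd3 H3]].
set (d := Rmin (Rmin d1 d2) (Rmin d3 e)).
assert (Hd : 0 < d) by (unfold d; repeat apply Rmin_pos; lra).
exists d; split; [exact Hd|].
intros [x y]; rewrite Cexp_0. intros Hxy.
replace ((x, y) - 0)%C with ((x, y) : C) in * by (apply injective_projections; simpl; ring).
assert (Hx := fst_le_Cmod (x, y)). assert (Hy := snd_le_Cmod (x, y)). simpl in Hx, Hy.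
set (m := Cmod (x, y)) in *.
assert (Hmd : m < d1 /\ m < d2 /\ m < d3 /\ m < e).
{ assert (d <= d1 /\ d <= d2 /\ d <= d3 /\ d <= e); [|lra].
  unfold d. repeat split.
  - eapply Rle_trans; [apply Rmin_l | apply Rmin_l].
  - eapply Rle_trans; [apply Rmin_l | apply Rmin_r].
  - eapply Rle_trans; [apply Rmin_r | apply Rmin_l].
  - eapply Rle_trans; [apply Rmin_r | apply Rmin_r]. }
specialize (H1 x ltac:(lra)). specialize (H2 y ltac:(lra)). specialize (H3 y ltac:(lra)).
rewrite Rplus_0_l, exp_0 in H1. rewrite Rplus_0_l, cos_0 in H2. rewrite Rplus_0_l, sin_0 in H3.
rewrite Rminus_0_r, Rmult_1_r in H3. rewrite Rmult_0_r, Rminus_0_r in H2. rewrite Rmult_1_r in H1.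
assert (Hm : 0 <= m) by apply Cmod_ge_0.
assert (Hc : Rabs (cos y) <= 1) by (apply Rabs_le; apply COS_bound).
assert (Hs : Rabs (sin y) <= 2 * m).
{ replace (sin y) with ((sin y - y) + y) by ring. eapply Rle_trans; [apply Rabs_triang|]. nra. }
assert (Hem : e * Rabs x <= e * m /\ e * Rabs y <= e * m) by (split; apply Rmult_le_compat_l; lra).
assert (Hex : Rabs (exp x - 1) <= 2 * e).
{ replace (exp x - 1) with ((exp x - 1 - x) + x) by ring. eapply Rle_trans; [apply Rabs_triang|]. nra. }
eapply Rle_trans; [apply Cmod_le_parts|].
unfold Cexp; simpl.
replace (exp x * cos y + - (1) + - (x * 1 - y * 0))
  with ((exp x - 1 - x) * cos y + (1 + x) * (cos y - 1)) by ring.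
replace (exp x * sin y + - 0 + - (x * 0 + y * 1))
  with ((exp x - 1) * sin y + (sin y - y)) by ring.
assert (A1 : Rabs ((exp x - 1 - x) * cos y) <= e * m).
{ rewrite Rabs_mult. apply Rle_trans with (e * m * 1); [|lra]. apply Rmult_le_compat; try apply Rabs_pos; lra. }
assert (A2 : Rabs ((1 + x) * (cos y - 1)) <= 2 * (e * m)).
{ rewrite Rabs_mult. apply Rmult_le_compat; try apply Rabs_pos; [|lra].
  eapply Rle_trans; [apply Rabs_triang|]. rewrite Rabs_R1; lra. }
assert (A3 : Rabs ((exp x - 1) * sin y) <= 2 * e * (2 * m)).
{ rewrite Rabs_mult. apply Rmult_le_compat; try apply Rabs_pos; lra. }
assert (A4 := Rabs_triang ((exp x - 1 - x) * cos y) ((1 + x) * (cos y - 1))).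
assert (A5 := Rabs_triang ((exp x - 1) * sin y) (sin y - y)).
apply Rle_trans with (8 * e * m); [lra|]. apply Rmult_le_compat_r; lra.
Qed.

Lemma cderiv_Cexp z : cderiv Cexp z (Cexp z).
Proof.
apply cderiv_ext_loc with (f := fun y => (Cexp z * Cexp (y - z))%C) (d := 1); [lra | |].
- intros y _. rewrite <- Cexp_plus. f_equal; ring.
- eapply cderiv_eq.
  + apply (cderiv_mult (fun _ => Cexp z)); [apply cderiv_const|].
    apply (cderiv_comp Cexp (fun y => y - z)%C).
    * replace (z - z)%C with (RtoC 0) by ring. apply cderiv_Cexp_0.
    * apply (cderiv_minus (fun y => y)); [apply cderiv_id | apply cderiv_const].
  + ring.
Qed.

Lemma Cexp_surj (z : C) : z <> 0%C -> exists s t : R, Cexp (s, t) = z.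
Proof.
intros Hz. assert (Hm : 0 < Cmod z) by now apply Cmod_gt_0.
set (r := Cmod z) in *. destruct z as [x y].
assert (Hr : x * x + y * y = r * r).
{ unfold r, Cmod; simpl fst; simpl snd. rewrite sqrt_sqrt; [ring|].
  apply Rplus_le_le_0_compat; apply pow2_ge_0. }
assert (Hx : -1 <= x / r <= 1).
{ assert (Hx := fst_le_Cmod (x, y)). simpl in Hx. fold r in Hx. apply Rabs_le_between in Hx.
  split; [apply Rle_div_r | apply Rle_div_l]; lra. }
assert (Hc : cos (acos (x / r)) = x / r) by now apply cos_acos.
assert (Hs : sin (acos (x / r)) = Rabs y / r).
{ rewrite sin_acos by exact Hx.
  replace (1 - Rsqr (x / r)) with (Rsqr (Rabs y / r)).
  - apply sqrt_Rsqr. apply Rdiv_le_0_compat; [apply Rabs_pos | lra].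
  - unfold Rsqr. assert (Rabs y * Rabs y = y * y) by (rewrite <- Rabs_mult; apply Rabs_pos_eq; nra).
    field_simplify; try lra. replace (Rabs y ^ 2) with (y * y) by (simpl; lra).
    replace (r ^ 2 - x ^ 2) with (y * y) by (simpl; lra). reflexivity. }
exists (ln r).
(* [acos] gives an argument in [0, pi], where the sine is non-negative; points of the lower half
   plane need its opposite. *)
destruct (Rle_dec 0 y) as [Hy|Hy].
- exists (acos (x / r)). unfold Cexp; simpl. rewrite exp_ln, Hc, Hs, Rabs_pos_eq by lra.
  f_equal; field; lra.
- exists (- acos (x / r)). unfold Cexp; simpl. rewrite exp_ln, cos_neg, sin_neg, Hc, Hs, Rabs_left by lra.
  f_equal; field; lra.
Qed.

(** * Goursat's theorem on rectangles *)


Lemma ccont_horizontal (u : C -> C) (x y : R) : ccont u (x, y) -> rcont (fun s => u (s, y)) x.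
Proof.
intros H. apply (continuous_comp (U := R_UniformSpace) (V := C_UniformSpace) (fun s => (s, y)) u); [|exact H].
apply (continuous_comp_2 (U := R_UniformSpace) (V := R_UniformSpace) (W := R_UniformSpace)
  (X := C_UniformSpace) (fun s => s) (fun _ => y) (fun a b => (a, b))).
- apply continuous_id.
- apply continuous_const.
- apply continuous_ext with (f := fun p => p); [now intros [] | apply continuous_id].
Qed.

Lemma ccont_vertical (u : C -> C) (x y : R) : ccont u (x, y) -> rcont (fun t => u (x, t)) y.
Proof.
intros H. apply (continuous_comp (U := R_UniformSpace) (V := C_UniformSpace) (fun t => (x, t)) u); [|exact H].
apply (continuous_comp_2 (U := R_UniformSpace) (V := R_UniformSpace) (W := R_UniformSpace)
  (X := C_UniformSpace) (fun _ => x) (fun t => t) (fun a b => (a, b))).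
- apply continuous_const.
- apply continuous_id.
- apply continuous_ext with (f := fun p => p); [now intros [] | apply continuous_id].
Qed.

Lemma ex_CInt_cont (f : R -> C) (a b : R) : a <= b ->
  (forall x, a <= x <= b -> rcont f x) -> ex_CInt f a b.
Proof.
intros Hab H. apply (@ex_RInt_continuous C_R_CompleteNormedModule).
intros z. rewrite Rmin_left, Rmax_right by lra. apply H.
Qed.

(** The integral is linear over the reals, so a complex factor is moved out through the real and
    imaginary parts. *)
Lemma is_CInt_mult_l (c : C) (f : R -> C) (a b : R) (l : C) :
  is_CInt f a b l -> is_CInt (fun x => c * f x)%C a b (c * l)%C.
Proof.
intros H.
assert (H1 := @is_RInt_fct_extend_fst R_NormedModule R_NormedModule f a b l H).
assert (H2 := @is_RInt_fct_extend_snd R_NormedModule R_NormedModule f a b l H).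
destruct c as [c1 c2].
apply (@is_RInt_fct_extend_pair R_NormedModule R_NormedModule).
- apply (@is_RInt_minus R_NormedModule); now apply (@is_RInt_scal R_NormedModule).
- apply (@is_RInt_plus R_NormedModule); now apply (@is_RInt_scal R_NormedModule).
Qed.

Lemma CInt_correct (f : R -> C) (a b : R) : ex_CInt f a b -> is_CInt f a b (CInt f a b).
Proof. apply (@RInt_correct C_R_CompleteNormedModule). Qed.

Lemma CInt_unique (f : R -> C) (a b : R) (l : C) : is_CInt f a b l -> CInt f a b = l.
Proof. apply (@is_RInt_unique C_R_CompleteNormedModule). Qed.

Lemma Cmod_CInt_le (f : R -> C) (a b : R) (M : R) : a <= b -> ex_CInt f a b ->
  (forall x, a <= x <= b -> Cmod (f x) <= M) -> Cmod (CInt f a b) <= (b - a) * M.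
Proof.
intros Hab Hf HM. rewrite Cmod_norm.
apply (@norm_RInt_le_const C_R_NormedModule f a b); [exact Hab | | now apply CInt_correct].
intros x Hx. rewrite <- Cmod_norm. now apply HM.
Qed.

Lemma is_derive_horizontal (P : C -> C) (x y : R) (l : C) : cderiv P (x, y) l ->
  @is_derive R_AbsRing C_R_NormedModule (fun s => P (s, y)) x l.
Proof.
intros H. split; [apply (@is_linear_scal_l R_AbsRing C_R_NormedModule)|].
intros x' Hx. assert (Hxx : x = x')
  by (apply (@is_filter_lim_locally_unique R_AbsRing (AbsRing_NormedModule R_AbsRing)); exact Hx).
rewrite <- Hxx. intros eps.
destruct (proj1 (cderiv_iff _ _ _) H eps (cond_pos eps)) as [d [Hd H1]].
exists (mkposreal d Hd). intros s Hs.
change (Rabs (s - x) < d) in Hs.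
rewrite <- Cmod_norm.
match goal with |- Cmod ?X <= _ => replace X
  with (P (s, y) - P (x, y) - ((s, y) - (x, y)) * l)%C end.
- assert (E : Cmod ((s, y) - (x, y)) = Rabs (s - x)).
  { rewrite <- Cmod_R. f_equal. apply injective_projections; simpl; ring. }
  change (norm (minus s x)) with (Rabs (s - x)). rewrite <- E.
  apply H1. now rewrite E.
- destruct l as [l1 l2].
  apply injective_projections; simpl; unfold scal, minus, plus, opp, mult; simpl;
  unfold mult, plus, opp; simpl; ring.
Qed.

Lemma is_derive_vertical (P : C -> C) (x y : R) (l : C) : cderiv P (x, y) l ->
  @is_derive R_AbsRing C_R_NormedModule (fun t => P (x, t)) y (Ci * l)%C.
Proof.
intros H. split; [apply (@is_linear_scal_l R_AbsRing C_R_NormedModule)|].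
intros y' Hy. assert (Hyy : y = y')
  by (apply (@is_filter_lim_locally_unique R_AbsRing (AbsRing_NormedModule R_AbsRing)); exact Hy).
rewrite <- Hyy. intros eps.
destruct (proj1 (cderiv_iff _ _ _) H eps (cond_pos eps)) as [d [Hd H1]].
exists (mkposreal d Hd). intros t Ht.
change (Rabs (t - y) < d) in Ht.
rewrite <- Cmod_norm.
match goal with |- Cmod ?X <= _ => replace X
  with (P (x, t) - P (x, y) - ((x, t) - (x, y)) * l)%C end.
- assert (E : Cmod ((x, t) - (x, y)) = Rabs (t - y)).
  { rewrite <- Cmod_R, <- (Rmult_1_l (Cmod (t - y)%R)), <- Cmod_Ci, <- Cmod_mult.
    f_equal. apply injective_projections; simpl; ring. }
  change (norm (minus t y)) with (Rabs (t - y)). rewrite <- E.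
  apply H1. now rewrite E.
- destruct l as [l1 l2].
  apply injective_projections; simpl; unfold scal, minus, plus, opp, mult; simpl;
  unfold mult, plus, opp; simpl; ring.
Qed.

Lemma is_CInt_horizontal (P p : C -> C) (a b y : R) : a <= b ->
  (forall x, a <= x <= b -> cderiv P (x, y) (p (x, y)) /\ ccont p (x, y)) ->
  is_CInt (fun x => p (x, y)) a b (P (b, y) - P (a, y))%C.
Proof.
intros Hab H.
apply (@is_RInt_derive C_R_CompleteNormedModule (fun x => P (x, y)) (fun x => p (x, y)));
  rewrite Rmin_left, Rmax_right by lra; intros x Hx; destruct (H x Hx) as [H1 H2].
- now apply is_derive_horizontal.
- now apply ccont_horizontal.
Qed.

Lemma is_CInt_vertical (P p : C -> C) (x a b : R) : a <= b ->
  (forall y, a <= y <= b -> cderiv P (x, y) (p (x, y)) /\ ccont p (x, y)) ->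
  is_CInt (fun y => Ci * p (x, y))%C a b (P (x, b) - P (x, a))%C.
Proof.
intros Hab H.
apply (@is_RInt_derive C_R_CompleteNormedModule (fun y => P (x, y)) (fun y => Ci * p (x, y))%C);
  rewrite Rmin_left, Rmax_right by lra; intros y Hy; destruct (H y Hy) as [H1 H2].
- now apply is_derive_vertical.
- apply (ccont_vertical (fun z => Ci * p z)%C x y).
  apply ccont_iff. intros eps He. destruct (proj1 (ccont_iff _ _) H2 eps He) as [d [Hd H3]].
  exists d; split; [exact Hd|]. intros z Hz.
  replace (Ci * p z - Ci * p (x, y))%C with (Ci * (p z - p (x, y)))%C by ring.
  rewrite Cmod_mult, Cmod_Ci, Rmult_1_l. now apply H3.
Qed.

(** * Boundary integrals over rectangles *)

Definition on_rect (Q : C -> Prop) (x1 x2 y1 y2 : R) : Prop :=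
  forall x y, x1 <= x <= x2 -> y1 <= y <= y2 -> Q (x, y).

(* Positively oriented boundary integral of [u dz]. *)
Definition rect_int (u : C -> C) (x1 x2 y1 y2 : R) : C :=
  (CInt (fun x => u (x, y1)) x1 x2 + Ci * CInt (fun y => u (x2, y)) y1 y2
   - CInt (fun x => u (x, y2)) x1 x2 - Ci * CInt (fun y => u (x1, y)) y1 y2)%C.

Lemma ex_CInt_horizontal u x1 x2 y1 y2 y : x1 <= x2 -> y1 <= y <= y2 ->
  on_rect (fun z => ccont u z) x1 x2 y1 y2 -> ex_CInt (fun x => u (x, y)) x1 x2.
Proof.
intros Hx Hy H. apply ex_CInt_cont; [exact Hx|]. intros x Hx'.
apply ccont_horizontal, H; lra.
Qed.

Lemma ex_CInt_vertical u x1 x2 y1 y2 x : y1 <= y2 -> x1 <= x <= x2 ->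
  on_rect (fun z => ccont u z) x1 x2 y1 y2 -> ex_CInt (fun y => u (x, y)) y1 y2.
Proof.
intros Hy Hx H. apply ex_CInt_cont; [exact Hy|]. intros y Hy'.
apply ccont_vertical, H; lra.
Qed.

Lemma on_rect_sub Q x1 x2 y1 y2 x1' x2' y1' y2' :
  x1 <= x1' -> x2' <= x2 -> y1 <= y1' -> y2' <= y2 ->
  on_rect Q x1 x2 y1 y2 -> on_rect Q x1' x2' y1' y2'.
Proof. intros A1 A2 A3 A4 H x y Hx Hy. apply H; lra. Qed.

Lemma CInt_Chasles (f : R -> C) (a b c : R) : ex_CInt f a b -> ex_CInt f b c ->
  CInt f a c = (CInt f a b + CInt f b c)%C.
Proof. intros; symmetry; now apply (@RInt_Chasles C_R_CompleteNormedModule). Qed.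

Lemma rect_int_split_x u x1 x2 x3 y1 y2 : x1 <= x2 -> x2 <= x3 -> y1 <= y2 ->
  on_rect (fun z => ccont u z) x1 x3 y1 y2 ->
  rect_int u x1 x3 y1 y2 = (rect_int u x1 x2 y1 y2 + rect_int u x2 x3 y1 y2)%C.
Proof.
intros H1 H2 H3 H. unfold rect_int.
assert (Ha : on_rect (fun z => ccont u z) x1 x2 y1 y2) by (apply (on_rect_sub _ x1 x3 y1 y2); auto; lra).
assert (Hb : on_rect (fun z => ccont u z) x2 x3 y1 y2) by (apply (on_rect_sub _ x1 x3 y1 y2); auto; lra).
rewrite (CInt_Chasles (fun x => u (x, y1)) x1 x2 x3), (CInt_Chasles (fun x => u (x, y2)) x1 x2 x3).
- ring.
- apply (ex_CInt_horizontal u x1 x2 y1 y2); auto; lra.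
- apply (ex_CInt_horizontal u x2 x3 y1 y2); auto; lra.
- apply (ex_CInt_horizontal u x1 x2 y1 y2); auto; lra.
- apply (ex_CInt_horizontal u x2 x3 y1 y2); auto; lra.
Qed.

Lemma rect_int_split_y u x1 x2 y1 y2 y3 : y1 <= y2 -> y2 <= y3 -> x1 <= x2 ->
  on_rect (fun z => ccont u z) x1 x2 y1 y3 ->
  rect_int u x1 x2 y1 y3 = (rect_int u x1 x2 y1 y2 + rect_int u x1 x2 y2 y3)%C.
Proof.
intros H1 H2 H3 H. unfold rect_int.
assert (Ha : on_rect (fun z => ccont u z) x1 x2 y1 y2) by (apply (on_rect_sub _ x1 x2 y1 y3); auto; lra).
assert (Hb : on_rect (fun z => ccont u z) x1 x2 y2 y3) by (apply (on_rect_sub _ x1 x2 y1 y3); auto; lra).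
rewrite (CInt_Chasles (fun y => u (x1, y)) y1 y2 y3), (CInt_Chasles (fun y => u (x2, y)) y1 y2 y3).
- ring.
- apply (ex_CInt_vertical u x1 x2 y1 y2); auto; lra.
- apply (ex_CInt_vertical u x1 x2 y2 y3); auto; lra.
- apply (ex_CInt_vertical u x1 x2 y1 y2); auto; lra.
- apply (ex_CInt_vertical u x1 x2 y2 y3); auto; lra.
Qed.

Lemma Cmod_rect_int_le u x1 x2 y1 y2 M : x1 <= x2 -> y1 <= y2 ->
  on_rect (fun z => ccont u z) x1 x2 y1 y2 ->
  on_rect (fun z => Cmod (u z) <= M) x1 x2 y1 y2 ->
  Cmod (rect_int u x1 x2 y1 y2) <= 2 * ((x2 - x1) + (y2 - y1)) * M.
Proof.
intros Hx Hy Hc HM. unfold rect_int.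
assert (A1 : Cmod (CInt (fun x => u (x, y1)) x1 x2) <= (x2 - x1) * M).
{ apply Cmod_CInt_le; [lra| |intros; apply HM; lra]. apply (ex_CInt_horizontal u x1 x2 y1 y2); auto; lra. }
assert (A2 : Cmod (CInt (fun x => u (x, y2)) x1 x2) <= (x2 - x1) * M).
{ apply Cmod_CInt_le; [lra| |intros; apply HM; lra]. apply (ex_CInt_horizontal u x1 x2 y1 y2); auto; lra. }
assert (A3 : Cmod (Ci * CInt (fun y => u (x1, y)) y1 y2) <= (y2 - y1) * M).
{ rewrite Cmod_mult, Cmod_Ci, Rmult_1_l.
  apply Cmod_CInt_le; [lra| |intros; apply HM; lra]. apply (ex_CInt_vertical u x1 x2 y1 y2); auto; lra. }
assert (A4 : Cmod (Ci * CInt (fun y => u (x2, y)) y1 y2) <= (y2 - y1) * M).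
{ rewrite Cmod_mult, Cmod_Ci, Rmult_1_l.
  apply Cmod_CInt_le; [lra| |intros; apply HM; lra]. apply (ex_CInt_vertical u x1 x2 y1 y2); auto; lra. }
unfold Cminus.
eapply Rle_trans; [apply Cmod_triangle|]. rewrite Cmod_opp.
eapply Rle_trans; [apply Rplus_le_compat_r, Cmod_triangle|]. rewrite Cmod_opp.
eapply Rle_trans; [apply Rplus_le_compat_r, Rplus_le_compat_r, Cmod_triangle|]. lra.
Qed.

Lemma CInt_minus (f g : R -> C) (a b : R) : ex_CInt f a b -> ex_CInt g a b ->
  CInt (fun x => f x - g x)%C a b = (CInt f a b - CInt g a b)%C.
Proof. apply (@RInt_minus C_R_CompleteNormedModule). Qed.

Lemma rect_int_minus u v x1 x2 y1 y2 : x1 <= x2 -> y1 <= y2 ->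
  on_rect (fun z => ccont u z) x1 x2 y1 y2 ->
  on_rect (fun z => ccont v z) x1 x2 y1 y2 ->
  rect_int (fun z => u z - v z)%C x1 x2 y1 y2
  = (rect_int u x1 x2 y1 y2 - rect_int v x1 x2 y1 y2)%C.
Proof.
intros Hx Hy Hu Hv. unfold rect_int.
rewrite (CInt_minus (fun x => u (x, y1)) (fun x => v (x, y1))),
  (CInt_minus (fun x => u (x, y2)) (fun x => v (x, y2)))
  by (apply (ex_CInt_horizontal _ x1 x2 y1 y2); auto; lra).
rewrite (CInt_minus (fun y => u (x1, y)) (fun y => v (x1, y))),
  (CInt_minus (fun y => u (x2, y)) (fun y => v (x2, y)))
  by (apply (ex_CInt_vertical _ x1 x2 y1 y2); auto; lra).
ring.
Qed.

Lemma CInt_mult_l (c : C) (f : R -> C) (a b : R) : ex_CInt f a b ->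
  CInt (fun x => c * f x)%C a b = (c * CInt f a b)%C.
Proof. intros H. now apply CInt_unique, is_CInt_mult_l, CInt_correct. Qed.

Lemma rect_int_primitive (P p : C -> C) x1 x2 y1 y2 : x1 <= x2 -> y1 <= y2 ->
  on_rect (fun z => cderiv P z (p z) /\ ccont p z) x1 x2 y1 y2 ->
  rect_int p x1 x2 y1 y2 = RtoC 0.
Proof.
intros Hx Hy H. unfold rect_int.
assert (Hc : on_rect (fun z => ccont p z) x1 x2 y1 y2) by (intros x y A B; now apply H).
rewrite <- (CInt_mult_l Ci (fun y => p (x1, y))), <- (CInt_mult_l Ci (fun y => p (x2, y)))
  by (apply (ex_CInt_vertical p x1 x2 y1 y2); auto; lra).
rewrite (CInt_unique _ _ _ _ (is_CInt_horizontal P p x1 x2 y1 Hx ltac:(intros; apply H; lra))).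
rewrite (CInt_unique _ _ _ _ (is_CInt_horizontal P p x1 x2 y2 Hx ltac:(intros; apply H; lra))).
rewrite (CInt_unique _ _ _ _ (is_CInt_vertical P p x1 y1 y2 Hy ltac:(intros; apply H; lra))).
rewrite (CInt_unique _ _ _ _ (is_CInt_vertical P p x2 y1 y2 Hy ltac:(intros; apply H; lra))).
ring.
Qed.

(** The left ends increase and each lies below every right end, so their supremum belongs to all the
    intervals. *)
Lemma nested_intervals (a : nat -> R) (w : R) : 0 < w ->
  (forall n, a n <= a (S n)) ->
  (forall n, a (S n) + w / 2 ^ S n <= a n + w / 2 ^ n) ->
  exists p, forall n, a n <= p <= a n + w / 2 ^ n.
Proof.
intros Hw H1 H2.
assert (Hpos : forall n, 0 < w / 2 ^ n) by (intros; apply Rdiv_lt_0_compat; [lra | apply pow_lt; lra]).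
assert (M1 : forall n k, a n <= a (n + k)%nat).
{ intros n k; induction k; [rewrite Nat.add_0_r; lra | rewrite Nat.add_succ_r; specialize (H1 (n + k)%nat); lra]. }
assert (M2 : forall n k, a (n + k)%nat + w / 2 ^ (n + k) <= a n + w / 2 ^ n).
{ intros n k; induction k; [rewrite Nat.add_0_r; lra | rewrite Nat.add_succ_r; specialize (H2 (n + k)%nat); lra]. }
assert (Hle : forall m n, a m <= a n + w / 2 ^ n).
{ intros m n. specialize (M1 m n). specialize (M2 n m). specialize (Hpos (n + m)%nat).
  rewrite (Nat.add_comm m n) in M1. lra. }
destruct (completeness (fun x => exists n, x = a n)) as [p [Hub Hlub]].
- exists (a 0%nat + w / 2 ^ 0). intros x [n ->]. apply Hle.
- exists (a 0%nat), 0%nat; reflexivity.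
- exists p. intros n; split.
  + apply Hub. now exists n.
  + apply Hlub. intros x [m ->]. apply Hle.
Qed.

Lemma pow_half_small (w d : R) : 0 < w -> 0 < d -> exists n, w / 2 ^ n < d.
Proof.
intros Hw Hd.
destruct (pow_lt_1_zero (/ 2) ltac:(rewrite Rabs_pos_eq; lra) (d / w) ltac:(now apply Rdiv_lt_0_compat)) as [n Hn].
exists n. specialize (Hn n (le_n n)). rewrite Rabs_pos_eq in Hn by (apply pow_le; lra).
rewrite pow_inv in Hn. unfold Rdiv at 1. apply Rlt_div_r in Hn; lra.
Qed.

(** Compactness in the form of Cousin's principle. Were the whole rectangle bad, one of its quarters
    would be bad, and so on; the nested bad rectangles shrink to a point around which every small
    rectangle is good. [P] takes the lower left corner, the width and the height. *)
Lemma rect_bisection (P : R -> R -> R -> R -> Prop) :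
  (forall x y w h, 0 < w -> 0 < h ->
     P x y (w / 2) (h / 2) -> P (x + w / 2) y (w / 2) (h / 2) ->
     P x (y + h / 2) (w / 2) (h / 2) -> P (x + w / 2) (y + h / 2) (w / 2) (h / 2) ->
     P x y w h) ->
  forall x0 y0 w0 h0, 0 < w0 -> 0 < h0 ->
  (forall px py, x0 <= px <= x0 + w0 -> y0 <= py <= y0 + h0 ->
     exists d, 0 < d /\ forall x y w h, 0 < w < d -> 0 < h < d ->
       x <= px <= x + w -> y <= py <= y + h -> P x y w h) ->
  P x0 y0 w0 h0.
Proof.
intros Hsplit x0 y0 w0 h0 Hw Hh Hloc.
destruct (classic (P x0 y0 w0 h0)) as [|Hn]; [assumption|exfalso].
assert (Wp : forall n, 0 < w0 / 2 ^ n) by (intros; apply Rdiv_lt_0_compat; [lra | apply pow_lt; lra]).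
assert (Hp : forall n, 0 < h0 / 2 ^ n) by (intros; apply Rdiv_lt_0_compat; [lra | apply pow_lt; lra]).
set (bad := fun n (s : R * R) => ~ P (fst s) (snd s) (w0 / 2 ^ n) (h0 / 2 ^ n)).
set (next := fun n (s s' : R * R) => bad (S n) s' /\
  (fst s' = fst s \/ fst s' = fst s + w0 / 2 ^ S n) /\
  (snd s' = snd s \/ snd s' = snd s + h0 / 2 ^ S n)).
assert (Hhalf : forall a n, a / 2 ^ n / 2 = a / 2 ^ S n).
{ intros a n. simpl. field. apply pow_nonzero; lra. }
assert (Hstep : forall n s, bad n s -> exists s', next n s s').
{ intros n [x y] Hb. unfold bad in Hb; simpl in Hb.
  destruct (classic (exists s', next n (x, y) s')) as [|Hno]; [assumption|].
  exfalso; apply Hb. apply Hsplit; auto; rewrite !Hhalf.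
  - apply NNPP; intros Hc. apply Hno; exists (x, y); repeat split; simpl; auto.
  - apply NNPP; intros Hc. apply Hno; exists (x + w0 / 2 ^ S n, y); repeat split; simpl; auto.
  - apply NNPP; intros Hc. apply Hno; exists (x, y + h0 / 2 ^ S n); repeat split; simpl; auto.
  - apply NNPP; intros Hc. apply Hno; exists (x + w0 / 2 ^ S n, y + h0 / 2 ^ S n); repeat split; simpl; auto. }
(* The default [(x0, y0)] only inhabits the type: by [Hstep] a bad rectangle has a bad quarter, so
   [epsilon] does select one. *)
set (s := fix s n := match n with
  | O => (x0, y0)
  | S n => epsilon (inhabits (x0, y0)) (next n (s n)) end).
assert (Hbad : forall n, bad n (s n)).
{ induction n as [|n IH].
  - unfold bad; simpl. now replace (w0 / 1) with w0 by field; replace (h0 / 1) with h0 by field.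
  - apply (epsilon_spec (inhabits (x0, y0)) (next n (s n))). now apply Hstep. }
assert (Hnext : forall n, next n (s n) (s (S n))).
{ intros n. apply (epsilon_spec (inhabits (x0, y0)) (next n (s n))). now apply Hstep. }
assert (Hdb : forall a n, a / 2 ^ n = a / 2 ^ S n + a / 2 ^ S n).
{ intros a n. simpl. field. apply pow_nonzero; lra. }
destruct (nested_intervals (fun n => fst (s n)) w0 Hw) as [px Hpx].
{ intros n. destruct (Hnext n) as [_ [H _]]. specialize (Wp (S n)). destruct H; lra. }
{ intros n. destruct (Hnext n) as [_ [H _]]. specialize (Wp (S n)). rewrite (Hdb w0 n). destruct H; lra. }
destruct (nested_intervals (fun n => snd (s n)) h0 Hh) as [py Hpy].
{ intros n. destruct (Hnext n) as [_ [_ H]]. specialize (Hp (S n)). destruct H; lra. }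
{ intros n. destruct (Hnext n) as [_ [_ H]]. specialize (Hp (S n)). rewrite (Hdb h0 n). destruct H; lra. }
destruct (Hloc px py) as [d [Hd H]].
{ specialize (Hpx 0%nat). simpl in Hpx. replace (w0 / 1) with w0 in Hpx by field. lra. }
{ specialize (Hpy 0%nat). simpl in Hpy. replace (h0 / 1) with h0 in Hpy by field. lra. }
(* Halving the sum w0 + h0 makes both sides small at the same index. *)
destruct (pow_half_small (w0 + h0) d) as [n Hsm]; [lra | lra |].
replace ((w0 + h0) / 2 ^ n) with (w0 / 2 ^ n + h0 / 2 ^ n) in Hsm by (field; apply pow_nonzero; lra).
specialize (Wp n). specialize (Hp n).
apply (Hbad n), H; auto; lra.
Qed.

(* The property [|rect_int u| <= eps * (w + h)^2] passes from the four quarters of a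
   rectangle to the whole; it holds near each point because affine functions have
   primitives. *)
Theorem goursat (u : C -> C) x1 x2 y1 y2 : x1 < x2 -> y1 < y2 ->
  on_rect (fun z => cdiff u z) x1 x2 y1 y2 ->
  rect_int u x1 x2 y1 y2 = RtoC 0.
Proof.
intros Hx Hy H.
assert (Hc : on_rect (fun z => ccont u z) x1 x2 y1 y2).
{ intros x y A B. destruct (H x y A B) as [l Hl]. now apply cderiv_cont with l. }
assert (Key : forall eps, 0 < eps ->
  Cmod (rect_int u x1 x2 y1 y2) <= eps * ((x2 - x1) + (y2 - y1)) ^ 2).
{ intros eps He.
  set (P := fun x y w h => x1 <= x -> x + w <= x2 -> y1 <= y -> y + h <= y2 ->
     Cmod (rect_int u x (x + w) y (y + h)) <= eps * (w + h) ^ 2).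
  assert (HP : P x1 y1 (x2 - x1) (y2 - y1)).
  { apply rect_bisection; try lra; unfold P; clear P.
    - intros x y w h Hw Hh A1 A2 A3 A4 B1 B2 B3 B4.
      specialize (A1 ltac:(lra) ltac:(lra) ltac:(lra) ltac:(lra)).
      specialize (A2 ltac:(lra) ltac:(lra) ltac:(lra) ltac:(lra)).
      specialize (A3 ltac:(lra) ltac:(lra) ltac:(lra) ltac:(lra)).
      specialize (A4 ltac:(lra) ltac:(lra) ltac:(lra) ltac:(lra)).
      replace (x + w / 2 + w / 2) with (x + w) in * by lra.
      replace (y + h / 2 + h / 2) with (y + h) in * by lra.
      rewrite (rect_int_split_x u x (x + w / 2) (x + w)) by
        (try lra; apply (on_rect_sub _ x1 x2 y1 y2); auto; lra).
      rewrite (rect_int_split_y u x (x + w / 2) y (y + h / 2) (y + h)) by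
        (try lra; apply (on_rect_sub _ x1 x2 y1 y2); auto; lra).
      rewrite (rect_int_split_y u (x + w / 2) (x + w) y (y + h / 2) (y + h)) by
        (try lra; apply (on_rect_sub _ x1 x2 y1 y2); auto; lra).
      (* Each quarter has half the value of w + h, and 4 * ((w + h) / 2)^2 = (w + h)^2: the square
         absorbs the number of quarters. *)
      eapply Rle_trans; [apply Cmod_triangle|].
      eapply Rle_trans; [apply Rplus_le_compat; apply Cmod_triangle|]. nra.
    - intros px py Hpx Hpy. destruct (H px py) as [l Hl]; try lra.
      destruct (proj1 (cderiv_iff _ _ _) Hl (eps / 2) ltac:(lra)) as [d [Hd Hdl]].
      (* Points of the small rectangle are within w + h < d of [(px, py)]. The earlier eps / 2
         cancels the factor 2 in the perimeter 2 (w + h). *)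
      exists (d / 2). split; [lra|]. intros x y w h Hw Hh Qx Qy B1 B2 B3 B4.
      set (aff := fun z => (u (px, py) + (z - (px, py)) * l)%C).
      set (Aff := fun z => (u (px, py) * z + (z - (px, py)) * (z - (px, py)) * (l / 2))%C).
      assert (D1 : forall z, cderiv aff z l).
      { intros z. unfold aff. eapply cderiv_eq.
        - apply (cderiv_plus (fun _ => u (px, py)) (fun z => (z - (px, py)) * l)%C); [apply cderiv_const|].
          apply (cderiv_mult (fun z => z - (px, py))%C (fun _ => l)); [|apply cderiv_const].
          apply (cderiv_minus (fun z => z)); [apply cderiv_id | apply cderiv_const].
        - ring. }
      assert (D2 : forall z, cderiv Aff z (aff z)).
      { intros z. unfold Aff. eapply cderiv_eq.
        - apply (cderiv_plus (fun z => u (px, py) * z)%C).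
          + apply (cderiv_mult (fun _ => u (px, py)) (fun z => z)); [apply cderiv_const | apply cderiv_id].
          + apply (cderiv_mult (fun z => (z - (px, py)) * (z - (px, py)))%C (fun _ => (l / 2)%C));
              [|apply cderiv_const].
            apply cderiv_mult; (apply (cderiv_minus (fun z => z)); [apply cderiv_id | apply cderiv_const]).
        - unfold aff. field. }
      assert (C1 : forall z, ccont aff z) by (intros z; apply cderiv_cont with l; apply D1).
      assert (Cu : on_rect (fun z => ccont u z) x (x + w) y (y + h))
        by (apply (on_rect_sub _ x1 x2 y1 y2); auto; lra).
      replace (rect_int u x (x + w) y (y + h))
        with (rect_int (fun z => u z - aff z)%C x (x + w) y (y + h)).
      + replace (eps * (w + h) ^ 2) with (2 * ((x + w - x) + (y + h - y)) * (eps / 2 * (w + h))) by field.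
        apply Cmod_rect_int_le; [lra | lra | |].
        * intros a b Ha Hb. destruct (H a b) as [m Hm]; try lra.
          apply cderiv_cont with (m - l)%C. apply cderiv_minus; [exact Hm | apply D1].
        * intros a b Ha Hb. unfold aff.
          assert (Hab : Cmod ((a, b) - (px, py)) <= w + h).
          { eapply Rle_trans; [apply Cmod_le_parts|]. simpl.
            apply Rplus_le_compat; apply Rabs_le; lra. }
          replace (u (a, b) - (u (px, py) + ((a, b) - (px, py)) * l))%C
            with (u (a, b) - u (px, py) - ((a, b) - (px, py)) * l)%C by ring.
          eapply Rle_trans; [apply Hdl; lra|]. apply Rmult_le_compat_l; lra.
      + rewrite rect_int_minus; try lra; [|exact Cu | intros a b _ _; apply C1].
        rewrite (rect_int_primitive Aff aff) by (try lra; intros a b _ _; split; auto).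
        ring. }
  unfold P in HP. replace (x1 + (x2 - x1)) with x2 in HP by ring.
  replace (y1 + (y2 - y1)) with y2 in HP by ring. apply HP; lra. }
apply Cmod_eq_0. apply Rle_antisym; [|apply Cmod_ge_0].
apply le_epsilon. intros eps He. rewrite Rplus_0_l.
set (S := ((x2 - x1) + (y2 - y1)) ^ 2) in *.
assert (HS : 0 < S) by (apply pow_lt; lra).
eapply Rle_trans; [apply (Key (eps / S)); now apply Rdiv_lt_0_compat|].
right; field; lra.
Qed.

(** A small square around the exceptional point is cut out. The four surrounding pieces avoid the
    point and contribute 0 by [goursat]; on the square [u] is bounded by continuity, so its boundary
    integral is at most a constant times the side. *)
Theorem goursat_except (u : C -> C) x1 x2 y1 y2 px py : x1 < px < x2 -> y1 < py < y2 ->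
  on_rect (fun z => ccont u z) x1 x2 y1 y2 ->
  on_rect (fun z => z <> (px, py) -> cdiff u z) x1 x2 y1 y2 ->
  rect_int u x1 x2 y1 y2 = RtoC 0.
Proof.
intros Hx Hy Hc H.
set (M := Cmod (u (px, py)) + 1).
assert (HM : 0 < M) by (unfold M; generalize (Cmod_ge_0 (u (px, py))); lra).
destruct (proj1 (ccont_iff _ _) (Hc px py ltac:(lra) ltac:(lra)) 1 Rlt_0_1) as [d [Hd Hdc]].
apply Cmod_eq_0. apply Rle_antisym; [|apply Cmod_ge_0].
apply le_epsilon. intros eps He. rewrite Rplus_0_l.
(* The first four bounds keep the square inside the rectangle, d / 4 keeps it where |u| <= M, and
   eps / (8 M) makes perimeter times M at most eps. *)
set (r := Rmin (Rmin (Rmin (px - x1) (x2 - px)) (Rmin (py - y1) (y2 - py))) (Rmin (d / 4) (eps / (8 * M)))).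
assert (Hr : 0 < r) by (unfold r; repeat apply Rmin_pos; try lra; apply Rdiv_lt_0_compat; lra).
assert (Hrs : r <= px - x1 /\ r <= x2 - px /\ r <= py - y1 /\ r <= y2 - py /\ r <= d / 4 /\ r <= eps / (8 * M)).
{ unfold r.
  generalize (Rmin_l (Rmin (Rmin (px - x1) (x2 - px)) (Rmin (py - y1) (y2 - py))) (Rmin (d / 4) (eps / (8 * M)))),
    (Rmin_r (Rmin (Rmin (px - x1) (x2 - px)) (Rmin (py - y1) (y2 - py))) (Rmin (d / 4) (eps / (8 * M)))),
    (Rmin_l (Rmin (px - x1) (x2 - px)) (Rmin (py - y1) (y2 - py))),
    (Rmin_r (Rmin (px - x1) (x2 - px)) (Rmin (py - y1) (y2 - py))),
    (Rmin_l (px - x1) (x2 - px)), (Rmin_r (px - x1) (x2 - px)),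
    (Rmin_l (py - y1) (y2 - py)), (Rmin_r (py - y1) (y2 - py)),
    (Rmin_l (d / 4) (eps / (8 * M))), (Rmin_r (d / 4) (eps / (8 * M))).
  intros; lra. }
clearbody r. destruct Hrs as [R1 [R2 [R3 [R4 [R5 R6]]]]].
(* Halving puts the square strictly inside, so that none of the four surrounding pieces
   degenerates. *)
set (r' := r / 2).
assert (Hr' : 0 < r' /\ r' < r) by (unfold r'; lra).
assert (Z : forall a1 a2 b1 b2, x1 <= a1 -> a1 < a2 -> a2 <= x2 -> y1 <= b1 -> b1 < b2 -> b2 <= y2 ->
  (px < a1 \/ a2 < px \/ py < b1 \/ b2 < py) -> rect_int u a1 a2 b1 b2 = RtoC 0).
{ intros a1 a2 b1 b2 E1 E2 E3 E4 E5 E6 Hout. apply goursat; try lra.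
  intros x y Ax Ay. apply H; try lra. intros E. inversion E; subst. lra. }
assert (S : forall a1 a2 b1 b2, x1 <= a1 -> a2 <= x2 -> y1 <= b1 -> b2 <= y2 ->
  on_rect (fun z => ccont u z) a1 a2 b1 b2)
  by (intros; apply (on_rect_sub _ x1 x2 y1 y2); auto; lra).
rewrite (rect_int_split_x u x1 (px - r') x2) by (try apply S; lra).
rewrite (rect_int_split_x u (px - r') (px + r') x2) by (try apply S; lra).
rewrite (rect_int_split_y u (px - r') (px + r') y1 (py - r') y2) by (try apply S; lra).
rewrite (rect_int_split_y u (px - r') (px + r') (py - r') (py + r') y2) by (try apply S; lra).
rewrite (Z x1 (px - r') y1 y2), (Z (px + r') x2 y1 y2), (Z (px - r') (px + r') y1 (py - r')),
  (Z (px - r') (px + r') (py + r') y2) by lra.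
rewrite !Cplus_0_l, !Cplus_0_r.
eapply Rle_trans; [apply (Cmod_rect_int_le u) with (M := M); [lra | lra | apply S; lra |]|].
- intros x y Ax Ay.
  assert (Hd' : Cmod ((x, y) - (px, py)) < d).
  { eapply Rle_lt_trans; [apply Cmod_le_parts|]. simpl.
    apply Rle_lt_trans with (r' + r'); [|lra].
    apply Rplus_le_compat; apply Rabs_le; lra. }
  specialize (Hdc _ Hd').
  generalize (Cmod_triangle_sub (u (x, y)) (u (px, py))). unfold M; lra.
- replace (2 * (px + r' - (px - r') + (py + r' - (py - r'))) * M) with (r * (8 * M) / 2) by (unfold r'; field).
  apply (Rmult_le_compat_r (8 * M)) in R6; [|lra].
  unfold Rdiv in R6 at 1. rewrite Rmult_assoc, Rinv_l in R6 by lra.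
  unfold r'; nra.
Qed.

(** * Cauchy's formula and Taylor expansions *)


Lemma Rlt_div_elim (a b c : R) : 0 < b -> a < c / b -> a * b < c.
Proof. intros Hb H. now apply (Rlt_div_r a c b Hb). Qed.


Lemma cdiff_cont (f : C -> C) (z : C) : cdiff f z -> ccont f z.
Proof. intros [l Hl]. now apply cderiv_cont with l. Qed.

Lemma cdiff_mult (f g : C -> C) (z : C) : cdiff f z -> cdiff g z -> cdiff (fun y => f y * g y)%C z.
Proof. intros [l Hl] [m Hm]. eexists. apply cderiv_mult; [exact Hl | exact Hm]. Qed.

Lemma cdiff_comp (f g : C -> C) (z : C) : cdiff f (g z) -> cdiff g z -> cdiff (fun y => f (g y)) z.
Proof. intros [l Hl] [m Hm]. eexists. apply (cderiv_comp f g); [exact Hl | exact Hm]. Qed.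

(** * Circle means in the logarithmic coordinate *)

Lemma unit_disc_Cexp (s t : R) : s < 0 -> unit_disc (Cexp (s, t)).
Proof. intros Hs. unfold unit_disc. rewrite Cmod_Cexp; simpl. rewrite <- exp_0. now apply exp_increasing. Qed.

Lemma CInt_period (f : R -> C) (T : R) : (forall t, rcont f t) ->
  (forall t, f (t + 2 * PI) = f t) -> CInt f T (T + 2 * PI) = CInt f 0 (2 * PI).
Proof.
intros Hc Hp.
assert (Hex : forall a b, ex_CInt f a b)
  by (intros a b; apply (@ex_RInt_continuous C_R_CompleteNormedModule); intros; apply Hc).
rewrite (CInt_Chasles f T 0), (CInt_Chasles f 0 (2 * PI)) by auto.
replace (CInt f (2 * PI) (T + 2 * PI)) with (CInt f 0 T).
- assert (E : (CInt f T 0 + CInt f 0 T)%C = RtoC 0).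
  { rewrite <- CInt_Chasles by auto. apply (@RInt_point C_R_CompleteNormedModule). }
  transitivity (CInt f 0 (2 * PI) + (CInt f T 0 + CInt f 0 T))%C; [in_C; ring | rewrite E; in_C; ring].
- assert (L := @RInt_comp_lin C_R_CompleteNormedModule f 1 (2 * PI) 0 T).
  rewrite !Rmult_1_l, Rplus_0_l in L. rewrite <- L by auto.
  apply (@RInt_ext C_R_CompleteNormedModule). intros t _.
  rewrite Rmult_1_l, Hp. symmetry. apply (@scal_one R_Ring C_R_ModuleSpace).
Qed.

Lemma rect_int_periodic (v : C -> C) (s1 s2 T : R) :
  (forall s t, v (s, t + 2 * PI) = v (s, t)) ->
  rect_int v s1 s2 T (T + 2 * PI) = RtoC 0 ->
  CInt (fun t => v (s1, t)) T (T + 2 * PI) = CInt (fun t => v (s2, t)) T (T + 2 * PI).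
Proof.
intros Hp H. unfold rect_int in H.
replace (CInt (fun x => v (x, T + 2 * PI)) s1 s2) with (CInt (fun x => v (x, T)) s1 s2) in H
  by (apply (@RInt_ext C_R_CompleteNormedModule); intros; now rewrite Hp).
set (A := CInt (fun t => v (s1, t)) _ _) in *. set (B := CInt (fun t => v (s2, t)) _ _) in *.
(* After cancellation of the horizontal sides, [H] says Ci * (B - A) = 0; a second factor [Ci]
   recovers B - A up to sign. *)
replace A with (B + Ci * (Ci * (B - A)))%C.
- replace (Ci * (B - A))%C with (RtoC 0); [in_C; ring|]. rewrite <- H. in_C; ring.
- replace (Ci * (Ci * (B - A)))%C with ((Ci * Ci) * (B - A))%C by (in_C; ring).
  replace (Ci * Ci)%C with (- RtoC 1)%C by (apply injective_projections; simpl; ring).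
  in_C; ring.
Qed.

(** The window of height 2 pi is centred at [py]: the exceptional point becomes interior, and its
    translates by multiples of 2 pi i fall outside. The shift of the window is paid for by
    periodicity. *)
Lemma line_mean_const_except (v : C -> C) (s1 s2 : R) (px py : R) :
  (forall s t, v (s, t + 2 * PI) = v (s, t)) ->
  s1 < px < s2 -> s2 < 0 ->
  (forall s t, s < 0 -> ccont v (s, t)) ->
  (forall s t, s < 0 -> py - PI <= t <= py + PI -> (s, t) <> (px, py) -> cdiff v (s, t)) ->
  CInt (fun t => v (s1, t)) 0 (2 * PI) = CInt (fun t => v (s2, t)) 0 (2 * PI).
Proof.
intros Hp Hs Hs2 Hc Hd.
rewrite <- (CInt_period (fun t => v (s1, t)) (py - PI)), <- (CInt_period (fun t => v (s2, t)) (py - PI));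
  try (intros t; apply Hp); try (intros t; apply ccont_vertical, Hc; lra).
apply rect_int_periodic; [exact Hp|].
assert (0 < PI) by apply PI_RGT_0.
apply goursat_except with px py; [lra | lra | |].
- intros s t A B. apply Hc; lra.
- intros s t A B E. apply Hd; try exact E; lra.
Qed.

Lemma line_mean_const (v : C -> C) (s1 s2 : R) :
  (forall s t, v (s, t + 2 * PI) = v (s, t)) ->
  s1 < s2 -> s2 < 0 -> (forall s t, s < 0 -> cdiff v (s, t)) ->
  CInt (fun t => v (s1, t)) 0 (2 * PI) = CInt (fun t => v (s2, t)) 0 (2 * PI).
Proof.
intros Hp Hs Hs2 Hd.
(* Any point between the two lines can be declared exceptional. *)
apply line_mean_const_except with ((s1 + s2) / 2) 0; auto; try lra.
intros; now apply cdiff_cont, Hd.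
Qed.

Definition diff_quot (f : C -> C) (a z : C) : C :=
  if Ceq_dec z a then C_derive f a else ((f z - f a) / (z - a))%C.

Lemma cdiff_diff_quot (f : C -> C) (a z : C) : z <> a -> cdiff f z -> cdiff (diff_quot f a) z.
Proof.
intros Hza [l Hl].
eexists. apply cderiv_ext_loc with (f := fun y => ((f y - f a) / (y - a))%C) (d := Cmod (z - a)).
- now apply Cmod_gt_0, Cminus_eq_contra.
- intros y Hy. unfold diff_quot. destruct (Ceq_dec y a) as [->|]; [|reflexivity].
  rewrite Cmod_sub_rev in Hy. lra.
- apply cderiv_div.
  + apply cderiv_minus; [exact Hl | apply cderiv_const].
  + apply (cderiv_minus (fun y => y)); [apply cderiv_id | apply cderiv_const].
  + now apply Cminus_eq_contra.
Qed.

Lemma ccont_diff_quot (f : C -> C) (a : C) : cdiff f a -> ccont (diff_quot f a) a.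
Proof.
intros H. apply cderiv_C_derive in H. apply ccont_iff. intros eps He.
destruct (proj1 (cderiv_iff _ _ _) H (eps / 2) ltac:(lra)) as [d [Hd H1]].
exists d; split; [exact Hd|]. intros y Hy. unfold diff_quot.
destruct (Ceq_dec a a) as [_|E]; [|easy].
destruct (Ceq_dec y a) as [|E].
- replace (C_derive f a - C_derive f a)%C with (RtoC 0) by ring. now rewrite Cmod_0.
- specialize (H1 y Hy). assert (E' := Cminus_eq_contra _ _ E).
  replace ((f y - f a) / (y - a) - C_derive f a)%C
    with ((f y - f a - (y - a) * C_derive f a) / (y - a))%C by (field; auto).
  rewrite Cmod_div by exact E'. apply Cmod_gt_0 in E'.
  apply Rle_lt_trans with (eps / 2); [|lra]. apply Rle_div_l; lra.
Qed.

Lemma ccont_diff_quot_all (f : C -> C) (a z : C) : cdiff f a -> cdiff f z -> ccont (diff_quot f a) z.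
Proof.
intros Ha Hz. destruct (Ceq_dec z a) as [->|E].
- now apply ccont_diff_quot.
- now apply cdiff_cont, cdiff_diff_quot.
Qed.

Lemma ccont_mult (f g : C -> C) (z : C) : ccont f z -> ccont g z -> ccont (fun y => f y * g y)%C z.
Proof.
intros Hf Hg. apply ccont_iff. intros eps He.
set (A := Cmod (f z) + 1). set (B := Cmod (g z) + 1).
assert (HA : 0 < A) by (unfold A; generalize (Cmod_ge_0 (f z)); lra).
assert (HB : 0 < B) by (unfold B; generalize (Cmod_ge_0 (g z)); lra).
destruct (proj1 (ccont_iff _ _) Hf (Rmin 1 (eps / (2 * B)))) as [d1 [Hd1 H1]].
{ apply Rmin_pos; [lra|]. apply Rdiv_lt_0_compat; lra. }
destruct (proj1 (ccont_iff _ _) Hg (eps / (2 * A))) as [d2 [Hd2 H2]].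
{ apply Rdiv_lt_0_compat; lra. }
exists (Rmin d1 d2). split; [now apply Rmin_pos|]. intros y Hy.
specialize (H1 y ltac:(eapply Rlt_le_trans; [exact Hy | apply Rmin_l])).
specialize (H2 y ltac:(eapply Rlt_le_trans; [exact Hy | apply Rmin_r])).
assert (H1a : Cmod (f y - f z) < 1) by (eapply Rlt_le_trans; [exact H1 | apply Rmin_l]).
assert (H1b : Cmod (f y - f z) < eps / (2 * B)) by (eapply Rlt_le_trans; [exact H1 | apply Rmin_r]).
replace (f y * g y - f z * g z)%C with ((f y - f z) * g z + f y * (g y - g z))%C by ring.
eapply Rle_lt_trans; [apply Cmod_triangle|]. rewrite !Cmod_mult.
assert (Hfy : Cmod (f y) <= A).
{ generalize (Cmod_triangle_sub (f y) (f z)). unfold A; lra. }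
apply Rlt_div_elim in H1b; [|lra].
apply Rlt_div_elim in H2; [|lra].
assert (Cmod (f y - f z) * Cmod (g z) <= Cmod (f y - f z) * B)
  by (apply Rmult_le_compat_l; [apply Cmod_ge_0 | unfold B; lra]).
assert (Cmod (f y) * Cmod (g y - g z) <= A * Cmod (g y - g z))
  by (apply Rmult_le_compat_r; [apply Cmod_ge_0 | lra]).
lra.
Qed.

Lemma ccont_comp (f g : C -> C) (z : C) : ccont f (g z) -> ccont g z -> ccont (fun y => f (g y)) z.
Proof. intros Hf Hg. now apply (continuous_comp g f). Qed.

Lemma cos_eq_1_small (x : R) : - PI <= x <= PI -> cos x = 1 -> x = 0.
Proof.
intros Hx H. assert (0 < PI) by apply PI_RGT_0.
replace x with (2 * (x / 2)) in H by lra. rewrite cos_2a_sin in H.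
assert (Hs : sin (x / 2) = 0) by nra.
destruct (Rtotal_order x 0) as [Hl|[E|Hg]]; [|exact E|].
- assert (0 < sin (- (x / 2))) by (apply sin_gt_0; lra). rewrite sin_neg in *; lra.
- assert (0 < sin (x / 2)) by (apply sin_gt_0; lra). lra.
Qed.

(** Both ends of the strip may be included because only t - t' matters: equal exponentials give cos
    (t - t') = 1, which on [-pi, pi] happens only at 0. *)
Lemma Cexp_inj_strip (s t s' t' : R) : t' - PI <= t <= t' + PI ->
  Cexp (s, t) = Cexp (s', t') -> (s, t) = (s', t').
Proof.
intros Ht H.
assert (Es : s = s').
{ apply exp_inv. change (exp (fst (s, t)) = exp (fst (s', t'))).
  now rewrite <- !Cmod_Cexp, H. }
subst s'. unfold Cexp in H; simpl in H. inversion H as [[H1 H2]].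
assert (He := exp_pos s).
apply Rmult_eq_reg_l in H1; [|lra]. apply Rmult_eq_reg_l in H2; [|lra].
assert (t - t' = 0); [|f_equal; lra].
apply cos_eq_1_small; [lra|]. rewrite cos_minus, H1, H2.
generalize (sin2_cos2 t'); unfold Rsqr; lra.
Qed.

Lemma exp_small (eps : R) (s0 : R) : 0 < eps -> exists s, s < s0 /\ exp s < eps.
Proof.
intros He. exists (Rmin s0 (ln eps) - 1).
assert (H1 := Rmin_l s0 (ln eps)). assert (H2 := Rmin_r s0 (ln eps)).
split; [lra|]. rewrite <- (exp_ln eps) at 2 by exact He. apply exp_increasing. lra.
Qed.

(* In the logarithmic coordinate the mean does not depend on the line [Re = s]
   (the pole at [log a] is put inside the strip), and it tends to 0 as [s -> -oo]. *)
Lemma circle_mean_diff_quot (f : C -> C) (a : C) (s : R) :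
  holomorphic_on unit_disc f -> s < 0 -> Cmod a < exp s ->
  CInt (fun t => Cexp (s, t) * diff_quot f a (Cexp (s, t)))%C 0 (2 * PI) = RtoC 0.
Proof.
intros Hf Hs Ha.
assert (HPI : 0 < PI) by apply PI_RGT_0.
assert (Hua : unit_disc a).
{ unfold unit_disc. eapply Rlt_trans; [exact Ha|]. rewrite <- exp_0. now apply exp_increasing. }
set (v := fun z => (Cexp z * diff_quot f a (Cexp z))%C).
change (CInt (fun t => v (s, t)) 0 (2 * PI) = RtoC 0).
assert (Hper : forall x t, v (x, t + 2 * PI) = v (x, t)) by (intros; unfold v; now rewrite Cexp_periodic).
assert (Hexpd : forall z, cdiff Cexp z) by (intros z; eexists; apply cderiv_Cexp).
assert (Hvc : forall x t, x < 0 -> ccont v (x, t)).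
{ intros x t Hx. unfold v. apply ccont_mult; [now apply cdiff_cont|].
  apply (ccont_comp (diff_quot f a) Cexp); [|now apply cdiff_cont].
  apply ccont_diff_quot_all; [now apply Hf | now apply Hf, unit_disc_Cexp]. }
assert (Hvd : forall x t, x < 0 -> Cexp (x, t) <> a -> cdiff v (x, t)).
{ intros x t Hx E. unfold v. apply cdiff_mult; [auto|].
  apply (cdiff_comp (diff_quot f a) Cexp); [|auto].
  apply cdiff_diff_quot; [exact E | now apply Hf, unit_disc_Cexp]. }
assert (H0 : unit_disc 0) by (unfold unit_disc; rewrite Cmod_0; lra).
destruct (proj1 (ccont_iff _ _) (ccont_diff_quot_all f a 0 (Hf a Hua) (Hf _ H0)) 1 Rlt_0_1) as [d [Hd Hdb]].
set (M := Cmod (diff_quot f a 0) + 1).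
assert (HM : 0 < M) by (unfold M; generalize (Cmod_ge_0 (diff_quot f a 0)); lra).
apply Cmod_eq_0. apply Rle_antisym; [|apply Cmod_ge_0].
apply le_epsilon. intros eps He. rewrite Rplus_0_l.
assert (Hpole : exists s0, s0 <= s /\ forall s1, s1 < s0 ->
   CInt (fun t => v (s1, t)) 0 (2 * PI) = CInt (fun t => v (s, t)) 0 (2 * PI)).
(* For a = 0 the logarithmic coordinate has no exceptional point at all. Otherwise the point is a
   logarithm of [a], lying to the left of [s] since |a| < exp s, and only lines further left are
   compared. *)
{ destruct (Ceq_dec a 0) as [Ea|Ea].
  - exists s. split; [lra|]. intros s1 Hs1.
    apply line_mean_const; auto. intros x t Hx. apply Hvd; [exact Hx|].
    rewrite Ea. apply Cexp_neq_0.
  - destruct (Cexp_surj a Ea) as [px [py Hp]].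
    assert (Hpx : px < s).
    { rewrite <- Hp, Cmod_Cexp in Ha. simpl in Ha. now apply exp_lt_inv. }
    exists px. split; [lra|]. intros s1 Hs1.
    apply line_mean_const_except with px py; auto.
    intros x t Hx Ht E. apply Hvd; [exact Hx|]. rewrite <- Hp. intros E'. apply E.
    now apply Cexp_inj_strip. }
destruct Hpole as [s0 [Hs0 Hpole]].
(* On such a circle the difference quotient is within 1 of its value at 0, so the integrand is at
   most exp s1 * M, over a length 2 pi. *)
destruct (exp_small (Rmin d (eps / (2 * PI * M))) s0) as [s1 [Hs1 Hsm]].
{ apply Rmin_pos; [exact Hd|]. apply Rdiv_lt_0_compat; [exact He|].
  apply Rmult_lt_0_compat; lra. }
rewrite <- (Hpole s1 Hs1).
assert (A1 : exp s1 < d) by (eapply Rlt_le_trans; [exact Hsm | apply Rmin_l]).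
assert (A2 : exp s1 < eps / (2 * PI * M)) by (eapply Rlt_le_trans; [exact Hsm | apply Rmin_r]).
apply Rlt_div_elim in A2; [|apply Rmult_lt_0_compat; lra].
eapply Rle_trans; [apply Cmod_CInt_le with (M := exp s1 * M)|].
- lra.
- apply ex_CInt_cont; [lra|]. intros t _. apply ccont_vertical, Hvc. lra.
- intros t _. unfold v. rewrite Cmod_mult, Cmod_Cexp; simpl.
  apply Rmult_le_compat_l; [apply Rlt_le, exp_pos|].
  assert (B : Cmod (Cexp (s1, t) - 0) < d).
  { replace (Cexp (s1, t) - 0)%C with (Cexp (s1, t)) by ring. now rewrite Cmod_Cexp. }
  specialize (Hdb _ B). generalize (Cmod_triangle_sub (diff_quot f a (Cexp (s1, t))) (diff_quot f a 0)).
  unfold M; lra.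
- lra.
Qed.

(* The Cauchy integral over the circle of radius [exp s], for [s < 0]. *)
Definition taylor_coef (f : C -> C) (s : R) (n : nat) : C :=
  (/ RtoC (2 * PI) * CInt (fun t => f (Cexp (s, t)) * (/ Cexp (s, t)) ^ n) 0 (2 * PI))%C.

Lemma cdiff_Cexp_inv_pow (n : nat) (z : C) : cdiff (fun z => (/ Cexp z) ^ n)%C z.
Proof.
eexists. apply (cderiv_pow (fun z => / Cexp z)%C). apply cderiv_inv; [apply cderiv_Cexp | apply Cexp_neq_0].
Qed.

Lemma cdiff_taylor_integrand (f : C -> C) (n : nat) (s t : R) : holomorphic_on unit_disc f -> s < 0 ->
  cdiff (fun z => f (Cexp z) * (/ Cexp z) ^ n)%C (s, t).
Proof.
intros Hf Hs. apply cdiff_mult; [|apply cdiff_Cexp_inv_pow].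
apply (cdiff_comp f Cexp); [now apply Hf, unit_disc_Cexp | eexists; apply cderiv_Cexp].
Qed.

(** This permits one fixed radius exp (-1) in the statements, while each estimate chooses a radius
    as close to 1 as it needs. *)
Lemma taylor_coef_indep (f : C -> C) (s1 s2 : R) (n : nat) : holomorphic_on unit_disc f ->
  s1 < 0 -> s2 < 0 -> taylor_coef f s1 n = taylor_coef f s2 n.
Proof.
intros Hf.
assert (H : forall a b, a < b -> b < 0 -> taylor_coef f a n = taylor_coef f b n).
{ intros a b Hab Hb. unfold taylor_coef. f_equal.
  apply (line_mean_const (fun z => f (Cexp z) * (/ Cexp z) ^ n)%C); auto.
  - intros s t. now rewrite Cexp_periodic.
  - intros s t Hs. now apply cdiff_taylor_integrand. }
intros H1 H2. destruct (Rtotal_order s1 s2) as [L|[->|L]]; [now apply H | reflexivity | symmetry; now apply H].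
Qed.

Lemma is_CInt_taylor (f : C -> C) (s : R) (n : nat) : holomorphic_on unit_disc f -> s < 0 ->
  is_CInt (fun t => f (Cexp (s, t)) * (/ Cexp (s, t)) ^ n)%C 0 (2 * PI)
    (RtoC (2 * PI) * taylor_coef f s n)%C.
Proof.
intros Hf Hs. assert (0 < PI) by apply PI_RGT_0. unfold taylor_coef.
assert (Hpi : RtoC (2 * PI) <> RtoC 0) by (intros E; apply RtoC_inj in E; lra).
rewrite Cmult_assoc, Cinv_r, Cmult_1_l by exact Hpi.
apply CInt_correct, ex_CInt_cont; [lra|]. intros t _.
apply (ccont_vertical (fun z => f (Cexp z) * (/ Cexp z) ^ n)%C).
now apply cdiff_cont, cdiff_taylor_integrand.
Qed.

(** In the logarithmic coordinate z^-n has the primitive - z^-n / n, which is periodic with period 2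
    pi i. *)
Lemma is_CInt_Cexp_inv_pow (s : R) (n : nat) : n <> 0%nat ->
  is_CInt (fun t => (/ Cexp (s, t)) ^ n)%C 0 (2 * PI) (RtoC 0).
Proof.
intros Hn. assert (0 < PI) by apply PI_RGT_0.
assert (Hn' : RtoC (INR n) <> RtoC 0) by (intros E; apply RtoC_inj in E; now apply (not_0_INR n)).
set (P := fun z => ((/ Cexp z) ^ n * (- / RtoC (INR n)))%C).
assert (HI := is_CInt_vertical P (fun z => (/ Cexp z) ^ n)%C s 0 (2 * PI) ltac:(lra)).
assert (HI' : is_CInt (fun y => Ci * (/ Cexp (s, y)) ^ n)%C 0 (2 * PI) (P (s, (2 * PI)%R) - P (s, 0%R))%C).
{ apply HI. intros t _. split; [|now apply cdiff_cont, cdiff_Cexp_inv_pow].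
  unfold P. eapply cderiv_eq.
  - apply (cderiv_mult (fun z => (/ Cexp z) ^ n)%C (fun _ => (- / RtoC (INR n))%C)); [|apply cderiv_const].
    apply (cderiv_pow (fun z => / Cexp z)%C). apply cderiv_inv; [apply cderiv_Cexp | apply Cexp_neq_0].
  - destruct n as [|n]; [easy|]. simpl pred. rewrite Cpow_S. field. split; [|exact Hn'].
    apply Cexp_neq_0. }
replace (P (s, (2 * PI)%R) - P (s, 0%R))%C with (RtoC 0) in HI'.
- apply (is_CInt_mult_l (- Ci)) in HI'.
  replace (- Ci * 0)%C with (RtoC 0) in HI' by ring.
  eapply (@is_RInt_ext C_R_NormedModule); [|exact HI'].
  intros t _. cbv beta; in_C. rewrite Cmult_assoc.
  replace (- Ci * Ci)%C with (RtoC 1) by (apply injective_projections; simpl; ring). ring.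
- unfold P. rewrite <- (Cexp_periodic s 0), Rplus_0_l. ring.
Qed.

(* Geometric sum: [(f z - f a) * sum_(n <= N) (a/z)^n] is the difference quotient
   times [z (1 - (a/z)^(N+1))]. *)
Lemma is_CInt_partial_sum (f : C -> C) (a : C) (s : R) (N : nat) :
  holomorphic_on unit_disc f -> s < 0 -> Cmod a < exp s ->
  is_CInt (fun t => Cexp (s, t) * diff_quot f a (Cexp (s, t)) * (1 - (a * / Cexp (s, t)) ^ S N))%C
    0 (2 * PI)
    (RtoC (2 * PI) * (csum (fun n => a ^ n * taylor_coef f s n)%C N - f a))%C.
Proof.
intros Hf Hs Ha.
assert (Hq : forall t, (Cexp (s, t) * diff_quot f a (Cexp (s, t)) * (1 - a * / Cexp (s, t)) = f (Cexp (s, t)) - f a)%C).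
{ intros t. unfold diff_quot. destruct (Ceq_dec (Cexp (s, t)) a) as [E|E].
  - exfalso. rewrite <- E, Cmod_Cexp in Ha. simpl in Ha. lra.
  - field. split; [apply Cexp_neq_0 | now apply Cminus_eq_contra]. }
induction N as [|N IH].
- rewrite sum_O. eapply (@is_RInt_ext C_R_NormedModule); [intros t _; symmetry; simpl Cpow|].
  + rewrite Cmult_1_r. apply Hq.
  + replace (RtoC (2 * PI) * (a ^ 0 * taylor_coef f s 0 - f a))%C
      with ((RtoC (2 * PI) * taylor_coef f s 0) - RtoC (2 * PI) * f a)%C by (simpl; ring).
    apply (@is_RInt_minus C_R_NormedModule).
    * eapply (@is_RInt_ext C_R_NormedModule); [|apply (is_CInt_taylor f s 0 Hf Hs)].
      intros t _. simpl. ring.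
    * assert (HC := @is_RInt_const C_R_NormedModule 0 (2 * PI) (f a)).
      rewrite Rminus_0_r, scal_R_Cmult in HC. exact HC.
- rewrite sum_Sn.
  match goal with |- is_CInt _ _ _ (_ * (plus ?S ?T - _))%C =>
    replace (RtoC (2 * PI) * (plus S T - f a))%C with
     (RtoC (2 * PI) * (S - f a) + RtoC (2 * PI) * T)%C end.
  2:{ match goal with |- context[plus ?S ?T] => change (plus S T) with (Cplus S T) end. ring. }
  eapply (@is_RInt_ext C_R_NormedModule); [|apply (@is_RInt_plus C_R_NormedModule); [exact IH|]].
  (* Passing from N to N + 1 adds a^(N+1) (f z - f a) z^-(N+1) to the integrand; the part with the
     constant f a has integral 0. *)
  2:{ assert (I1 := is_CInt_taylor f s (S N) Hf Hs).
      assert (I2 := is_CInt_mult_l (f a) _ _ _ _ (is_CInt_Cexp_inv_pow s (S N) ltac:(easy))).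
      assert (I3 := is_CInt_mult_l (a ^ S N) _ _ _ _ (@is_RInt_minus C_R_NormedModule _ _ _ _ _ _ I1 I2)).
      match type of I3 with is_CInt _ _ _ ?X =>
        replace X with (RtoC (2 * PI) * (a ^ S N * taylor_coef f s (S N)))%C in I3 end.
      - exact I3.
      - match goal with |- context[minus ?S ?T] => change (minus S T) with (Cminus S T) end. ring. }
  intros t _. cbv beta.
  match goal with |- plus ?A (?c * (minus ?X ?Y))%C = _ =>
    change (plus A (c * minus X Y)%C) with (A + c * (X - Y))%C end.
  replace (f (Cexp (s, t)) * (/ Cexp (s, t)) ^ S N - f a * (/ Cexp (s, t)) ^ S N)%C
    with ((f (Cexp (s, t)) - f a) * (/ Cexp (s, t)) ^ S N)%C by ring.
  rewrite <- Hq, !Cpow_mult_l, !Cpow_S. in_C; ring.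
Qed.

(** * Convergence of the Taylor series *)

Lemma Cpow_pow_n (z : C) (n : nat) : @pow_n C_Ring z n = (z ^ n)%C.
Proof. induction n as [|n IH]; [reflexivity|]. simpl. now rewrite IH. Qed.

Lemma is_pseries_iff (b : nat -> C) (z l : C) :
  is_cpseries b z l <->
  forall eps, 0 < eps -> exists N, forall n, (N <= n)%nat ->
    Cmod (csum (fun k => z ^ k * b k)%C n - l) < eps.
Proof.
assert (E : forall n, sum_n (G := C_NormedModule) (fun k => scal (pow_n (K := C_AbsRing) z k) (b k)) n
   = csum (fun k => z ^ k * b k)%C n).
{ intros n. apply sum_n_ext. intros k. now rewrite <- Cpow_pow_n. }
unfold is_pseries, is_series.
split.
- intros H eps He.
  assert (L : locally (T := C_UniformSpace) l (fun w => Cmod (w - l) < eps)).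
  { apply locally_C. exists (mkposreal eps He). intros w Hw; exact Hw. }
  destruct (H _ L) as [N HN]. exists N. intros n Hn. specialize (HN n Hn). cbv beta in HN.
  rewrite E in HN. exact HN.
- intros H P HP. apply locally_C in HP. destruct HP as [e He].
  destruct (H e (cond_pos e)) as [N HN]. exists N. intros n Hn.
  apply He. rewrite E. apply (HN n Hn).
Qed.

Lemma pow_small (q A : R) : 0 <= q < 1 -> 0 <= A -> forall eps, 0 < eps ->
  exists N, forall n, (N <= n)%nat -> q ^ n * A < eps.
Proof.
intros Hq HA eps He.
destruct (pow_lt_1_zero q ltac:(rewrite Rabs_pos_eq; lra) (eps / (A + 1)) ltac:(apply Rdiv_lt_0_compat; lra)) as [N HN].
exists N. intros n Hn. specialize (HN n Hn).
assert (Hp : 0 <= q ^ n) by (apply pow_le; lra).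
rewrite Rabs_pos_eq in HN by exact Hp.
apply Rlt_div_elim in HN; [|lra]. nra.
Qed.

(** Let v be z times the difference quotient at a. Its circle mean vanishes, so
    [is_CInt_partial_sum] expresses the error of the partial sum as minus the mean of v (a/z)^(n+1).
    On a circle of radius exp s > |a| the function v is bounded and |a/z| = q < 1. *)
Theorem holomorphic_taylor (f : C -> C) : holomorphic_on unit_disc f ->
  forall a, unit_disc a ->
    is_cpseries (taylor_coef f (-1)) a (f a).
Proof.
intros Hf a Ha. unfold unit_disc in Ha.
assert (HPI : 0 < PI) by apply PI_RGT_0.
assert (Hm := Cmod_ge_0 a).
assert (Hr : exists s, s < 0 /\ Cmod a < exp s).
{ exists (ln ((Cmod a + 1) / 2)). rewrite exp_ln by lra. split; [|lra].
  rewrite <- ln_1. apply ln_increasing; lra. }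
destruct Hr as [s [Hs Has]].
assert (Hes := exp_pos s).
set (v := fun z => (Cexp z * diff_quot f a (Cexp z))%C).
assert (Hvc : forall t, ccont v (s, t)).
{ intros t. assert (cdiff Cexp (s, t)) by (eexists; apply cderiv_Cexp).
  unfold v. apply ccont_mult; [now apply cdiff_cont|].
  apply (ccont_comp (diff_quot f a) Cexp); [|now apply cdiff_cont].
  apply ccont_diff_quot_all; [now apply Hf | now apply Hf, unit_disc_Cexp]. }
destruct (@bounded_continuity R_AbsRing C_R_NormedModule (fun t => v (s, t)) 0 (2 * PI)) as [B HB].
{ intros t _. apply (ccont_vertical v), Hvc. }
assert (HB' : forall t, 0 <= t <= 2 * PI -> Cmod (v (s, t)) <= Rabs B).
{ intros t Ht. rewrite Cmod_norm. eapply Rle_trans; [apply Rlt_le, (HB t Ht) | apply Rle_abs]. }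
set (q := Cmod a / exp s).
assert (Hq : 0 <= q < 1).
{ unfold q; split; [apply Rdiv_le_0_compat; lra | apply Rlt_div_l; lra]. }
apply is_pseries_iff. intros eps He.
destruct (pow_small q (Rabs B) Hq (Rabs_pos B) eps He) as [N HN].
exists N. intros n Hn. specialize (HN (S n) ltac:(lia)).
rewrite (sum_n_ext _ (fun k => (a ^ k * taylor_coef f s k)%C))
  by (intros k; now rewrite (taylor_coef_indep f (-1) s) by (auto; lra)).
set (S0 := (csum _ n - f a)%C).
assert (I1 := is_CInt_partial_sum f a s n Hf Hs Has). fold S0 in I1.
assert (Ev : ex_CInt (fun t => v (s, t)) 0 (2 * PI)).
{ apply ex_CInt_cont; [lra|]. intros t _. apply (ccont_vertical v), Hvc. }
assert (I2 := CInt_correct _ _ _ Ev).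
unfold v in I2. rewrite (circle_mean_diff_quot f a s Hf Hs Has) in I2.
assert (I3 := @is_RInt_minus C_R_NormedModule _ _ _ _ _ _ I2 I1).
assert (HI : Cmod (RtoC (2 * PI) * S0) <= (2 * PI - 0) * (q ^ S n * Rabs B)).
{ rewrite <- Cmod_opp.
  replace (- (RtoC (2 * PI) * S0))%C with (minus (G := C_AbelianGroup) (RtoC 0) (RtoC (2 * PI) * S0)%C)
    by (change (0 - RtoC (2 * PI) * S0 = - (RtoC (2 * PI) * S0))%C; ring).
  rewrite Cmod_norm.
  eapply (@norm_RInt_le_const C_R_NormedModule); [lra | | exact I3].
  intros t Ht. rewrite <- Cmod_norm.
  match goal with |- Cmod (minus ?A ?B') <= _ => change (minus A B') with (A - B')%C end.
  match goal with |- Cmod ?X <= _ => replace X with ((a * / Cexp (s, t)) ^ S n * v (s, t))%C by (unfold v; ring) end.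
  rewrite Cmod_mult, Cmod_pow, Cmod_mult, Cmod_inv, Cmod_Cexp by apply Cexp_neq_0. simpl fst.
  apply Rmult_le_compat_l; [apply pow_le; fold (Cmod a / exp s); fold q; lra | now apply HB']. }
rewrite Cmod_mult, Cmod_R, Rabs_pos_eq in HI by lra.
rewrite Rminus_0_r in HI. apply Rmult_le_reg_l in HI; lra.
Qed.

(** * Termwise differentiation *)

Definition has_series (f : C -> C) (b : nat -> C) : Prop :=
  forall z, unit_disc z -> is_cpseries b z (f z).

Definition deriv_coef (b : nat -> C) (n : nat) : C := (RtoC (INR (S n)) * b (S n))%C.


Lemma csum_S (u : nat -> C) (n : nat) : csum u (S n) = (csum u n + u (S n))%C.
Proof. apply (sum_Sn (G := C_AbelianMonoid)). Qed.

(** Abel's argument: the terms of the convergent series at a real s between |x| and 1 are bounded.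
    Passing to the moduli of the coefficients turns absolute convergence into a statement about the
    real [CV_radius]. *)
Lemma has_series_CV_radius (f : C -> C) (b : nat -> C) (x : R) : has_series f b -> Rabs x < 1 ->
  Rbar_lt (Rabs x) (CV_radius (fun n => Cmod (b n))).
Proof.
intros H Hx.
set (s := (Rabs x + 1) / 2). assert (Hx0 := Rabs_pos x).
assert (Hs : Rabs x < s < 1) by (unfold s; lra).
apply Rbar_lt_le_trans with (Finite s); [simpl; lra|].
apply (proj1 (CV_radius_bounded (fun n => Cmod (b n)))).
assert (Hd : unit_disc (RtoC s)) by (unfold unit_disc; rewrite Cmod_R, Rabs_pos_eq; lra).
destruct (proj1 (is_pseries_iff _ _ _) (H _ Hd) 1 Rlt_0_1) as [N HN].
set (u := fun k => (RtoC s ^ k * b k)%C) in *.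
assert (Hfin : exists M, forall n, (n <= S N)%nat -> Cmod (u n) <= M).
{ generalize (S N); clear. intros m. induction m as [|m [M HM]].
  - exists (Cmod (u 0%nat)). intros n Hn. replace n with 0%nat by lia. lra.
  - exists (Rmax M (Cmod (u (S m)))). intros n Hn.
    destruct (Nat.eq_dec n (S m)) as [->|E]; [apply Rmax_r|].
    eapply Rle_trans; [apply HM; lia | apply Rmax_l]. }
destruct Hfin as [M HM].
(* Beyond index N + 1 a term is the difference of two partial sums, each within 1 of [f s], whence
   the 2. *)
exists (Rmax M 2). intros n.
replace (Rabs (Cmod (b n) * s ^ n)) with (Cmod (u n)).
- destruct (Compare_dec.le_lt_dec n (S N)) as [Hn|Hn].
  + eapply Rle_trans; [now apply HM | apply Rmax_l].
  + eapply Rle_trans; [|apply Rmax_r]. destruct n as [|n]; [lia|].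
    assert (H1 := HN n ltac:(lia)). assert (H2 := HN (S n) ltac:(lia)).
    rewrite csum_S in H2.
    replace (u (S n)) with ((csum u n + u (S n) - f s) - (csum u n - f s))%C by ring.
    unfold Cminus at 1. eapply Rle_trans; [apply Cmod_triangle|]. rewrite Cmod_opp. lra.
- unfold u. rewrite Cmod_mult, Cmod_pow, Cmod_R, (Rabs_pos_eq s) by lra.
  rewrite Rabs_pos_eq; [ring|]. apply Rmult_le_pos; [apply Cmod_ge_0 | apply pow_le; lra].
Qed.

Definition pow_rem (y z : C) (n : nat) : C := (y ^ n - z ^ n - RtoC (INR n) * z ^ (pred n) * (y - z))%C.

Lemma pow_rem_S (y z : C) (n : nat) :
  pow_rem y z (S n) = (y * pow_rem y z n + RtoC (INR n) * z ^ (pred n) * (y - z) * (y - z))%C.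
Proof.
unfold pow_rem. rewrite S_INR, RtoC_plus. destruct n as [|n].
- simpl. ring.
- rewrite S_INR, RtoC_plus. simpl pred. rewrite !Cpow_S. ring.
Qed.

(** Twice the bound from Taylor's formula, but with the second derivative of r^(n+2) as its factor:
    weighted by |b (n+2)| these are the terms of a twice differentiated power series. *)
Lemma Cmod_pow_rem_le (y z : C) (r : R) (n : nat) : Cmod y <= r -> Cmod z <= r ->
  Cmod (pow_rem y z (S (S n))) <= INR (S (S n)) * INR (S n) * r ^ n * Cmod (y - z) ^ 2.
Proof.
intros Hy Hz. assert (Hy0 := Cmod_ge_0 y). assert (Hz0 := Cmod_ge_0 z).
assert (Hh := Cmod_ge_0 (y - z)). set (h := Cmod (y - z)) in *.
induction n as [|n IH].
- replace (pow_rem y z 2) with ((y - z) * (y - z))%C by (unfold pow_rem; simpl; rewrite RtoC_plus; ring).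
  rewrite Cmod_mult. fold h. simpl. nra.
- rewrite pow_rem_S. eapply Rle_trans; [apply Cmod_triangle|].
  rewrite !Cmod_mult, Cmod_pow, Cmod_R, Rabs_pos_eq by apply pos_INR. fold h. simpl pred.
  assert (A : Cmod y * Cmod (pow_rem y z (S (S n))) <=
    r * (INR (S (S n)) * INR (S n) * r ^ n * h ^ 2)) by (apply Rmult_le_compat; auto; apply Cmod_ge_0).
  assert (B : Cmod z ^ S n <= r ^ S n) by (apply pow_incr; lra).
  assert (Hr : 0 <= r ^ S n) by (apply pow_le; lra).
  assert (Hi : 0 <= INR (S (S n))) by apply pos_INR.
  assert (D : INR (S (S n)) * Cmod z ^ S n * h * h <= INR (S (S n)) * r ^ S n * h * h).
  { do 2 (apply Rmult_le_compat_r; [exact Hh|]). now apply Rmult_le_compat_l. }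
  apply Rle_trans with (INR (S (S n)) * (INR (S n) + 1) * r ^ S n * h ^ 2).
  + simpl pow in *. lra.
  + rewrite <- S_INR, (S_INR (S (S n))).
    assert (0 <= r ^ S n * h ^ 2) by (apply Rmult_le_pos; [exact Hr | apply pow2_ge_0]). nra.
Qed.

(** The second factor on the right is a partial sum of a series convergent for r < 1, so the error
    of linearisation is quadratic in y - z uniformly in N. *)
Lemma taylor_partial_le (b : nat -> C) (y z : C) (r : R) (N : nat) : Cmod y <= r -> Cmod z <= r ->
  Cmod (csum (fun k => y ^ k * b k)%C (S (S N)) - csum (fun k => z ^ k * b k)%C (S (S N))
        - (y - z) * csum (fun k => z ^ k * deriv_coef b k)%C (S N)) <=
  Cmod (y - z) ^ 2 * sum_n (fun n => PS_derive (PS_derive (fun n => Cmod (b n))) n * r ^ n) N.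
Proof.
intros Hy Hz.
(* Indexed so that [T 0] concerns polynomials of degree one, which have no remainder. *)
set (T := fun N => (csum (fun k => y ^ k * b k)%C (S N) - csum (fun k => z ^ k * b k)%C (S N)
        - (y - z) * csum (fun k => z ^ k * deriv_coef b k)%C N)%C).
assert (HT0 : T 0%nat = RtoC 0).
{ unfold T. rewrite !csum_S, !sum_O. unfold deriv_coef. simpl. ring. }
assert (HTS : forall n, T (S n) = (T n + b (S (S n)) * pow_rem y z (S (S n)))%C).
{ intros n. unfold T. rewrite (csum_S (fun k => y ^ k * b k)%C (S n)), (csum_S (fun k => z ^ k * b k)%C (S n)),
    (csum_S (fun k => z ^ k * deriv_coef b k)%C n).
  unfold deriv_coef, pow_rem. simpl pred. ring. }
change (Cmod (T (S N)) <= Cmod (y - z) ^ 2 * sum_n (fun n => PS_derive (PS_derive (fun n => Cmod (b n))) n * r ^ n) N).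
assert (Hb : forall n, Cmod (b (S (S n)) * pow_rem y z (S (S n))) <=
  Cmod (y - z) ^ 2 * (PS_derive (PS_derive (fun n => Cmod (b n))) n * r ^ n)).
{ intros n. rewrite Cmod_mult. unfold PS_derive.
  eapply Rle_trans; [apply Rmult_le_compat_l; [apply Cmod_ge_0 | now apply Cmod_pow_rem_le with (r := r)]|].
  right; ring. }
induction N as [|N IH].
- rewrite HTS, HT0, Cplus_0_l, sum_O. apply Hb.
- rewrite HTS, sum_Sn. eapply Rle_trans; [apply Cmod_triangle|].
  change plus with Rplus. rewrite Rmult_plus_distr_l. apply Rplus_le_compat; [exact IH | apply Hb].
Qed.

Lemma partial_sum_le_Series (u : nat -> R) (n : nat) : (forall k, 0 <= u k) -> ex_series u ->
  sum_n u n <= Series u.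
Proof.
intros Hu He. apply (is_lim_seq_incr_compare (sum_n u) (Series u)).
- now apply Series_correct.
- intros k. rewrite sum_Sn. change plus with Rplus. specialize (Hu (S k)). lra.
Qed.

Lemma has_series_deriv_coef (f : C -> C) (b : nat -> C) (z : C) : has_series f b -> unit_disc z ->
  exists l, is_cpseries (deriv_coef b) z l.
Proof.
intros H Hz.
assert (Hm : Rabs (Cmod z) < 1) by (rewrite Rabs_pos_eq; [exact Hz | apply Cmod_ge_0]).
assert (L := has_series_CV_radius f b (Cmod z) H Hm).
rewrite <- CV_radius_derive in L. apply CV_disk_inside in L.
apply (@ex_series_le C_AbsRing C_CompleteNormedModule) with (2 := L).
intros n. change (Cmod (@pow_n C_Ring z n * deriv_coef b n) <= Rabs (PS_derive (fun n => Cmod (b n)) n * Cmod z ^ n)).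
rewrite Cpow_pow_n. unfold deriv_coef, PS_derive.
rewrite !Cmod_mult, Cmod_pow, Cmod_R, (Rabs_pos_eq (INR _)), Rabs_pos_eq; [right; ring | | apply pos_INR].
repeat apply Rmult_le_pos; [apply pos_INR | apply Cmod_ge_0 | apply pow_le, Cmod_ge_0].
Qed.

(** With r between |z| and 1 and K the sum of the twice differentiated majorant at r, letting N grow
    in [taylor_partial_le] leaves an error of at most K |y - z|^2. *)
Lemma has_series_cderiv (f : C -> C) (b : nat -> C) (z l : C) : has_series f b -> unit_disc z ->
  is_cpseries (deriv_coef b) z l -> cderiv f z l.
Proof.
intros H Hz Hl. unfold unit_disc in Hz. assert (Hz0 := Cmod_ge_0 z).
set (r := (Cmod z + 1) / 2). assert (Hr : Cmod z < r < 1) by (unfold r; lra).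
set (u := fun n => PS_derive (PS_derive (fun n => Cmod (b n))) n * r ^ n).
assert (Hu0 : forall n, 0 <= u n).
{ intros n. unfold u, PS_derive.
  repeat apply Rmult_le_pos; try apply pos_INR; [apply Cmod_ge_0 | apply pow_le; lra]. }
assert (Hu : ex_series u).
{ apply ex_series_ext with (fun n => Rabs (u n)); [intros n; now apply Rabs_pos_eq|].
  apply CV_disk_inside. rewrite !CV_radius_derive. apply (has_series_CV_radius f b r H).
  rewrite Rabs_pos_eq; lra. }
set (K := Series u).
assert (HK : 0 <= K) by (eapply Rle_trans; [apply (Hu0 0%nat) | rewrite <- (sum_O u); now apply partial_sum_le_Series]).
assert (Main : forall y, Cmod y <= r -> Cmod (f y - f z - (y - z) * l) <= Cmod (y - z) ^ 2 * K).
{ intros y Hy. assert (Hyd : unit_disc y) by (unfold unit_disc; lra).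
  set (h := Cmod (y - z)). assert (Hh : 0 <= h) by apply Cmod_ge_0.
  apply le_epsilon. intros eps He.
  (* The three truncation errors, for f y, f z and l, enter with weights 1, 1 and h. *)
  set (e := eps / (2 + h)). assert (He' : 0 < e) by (apply Rdiv_lt_0_compat; lra).
  destruct (proj1 (is_pseries_iff _ _ _) (H y Hyd) e He') as [N1 H1].
  destruct (proj1 (is_pseries_iff _ _ _) (H z Hz) e He') as [N2 H2].
  destruct (proj1 (is_pseries_iff _ _ _) Hl e He') as [N3 H3].
  set (N := (N1 + N2 + N3)%nat).
  specialize (H1 (S (S N)) ltac:(lia)). specialize (H2 (S (S N)) ltac:(lia)). specialize (H3 (S N) ltac:(lia)).
  assert (HT := taylor_partial_le b y z r N Hy ltac:(lra)).
  fold u in HT. fold h in HT.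
  set (Sy := csum _ (S (S N))) in HT, H1. set (Sz := csum (fun k => z ^ k * b k)%C _) in HT, H2.
  set (Sd := csum _ (S N)) in HT, H3.
  replace (f y - f z - (y - z) * l)%C
    with ((Sy - Sz - (y - z) * Sd) + (- (Sy - f y) + ((Sz - f z) + (y - z) * (Sd - l))))%C by ring.
  eapply Rle_trans; [apply Cmod_triangle|].
  apply Rplus_le_compat.
  - eapply Rle_trans; [exact HT|]. apply Rmult_le_compat_l; [apply pow2_ge_0|].
    now apply partial_sum_le_Series.
  - eapply Rle_trans; [apply Cmod_triangle|]. rewrite Cmod_opp.
    eapply Rle_trans; [apply Rplus_le_compat_l, Cmod_triangle|]. rewrite Cmod_mult. fold h.
    replace eps with (e + (e + h * e)) by (unfold e; field; lra).
    apply Rplus_le_compat; [lra|]. apply Rplus_le_compat; [lra|].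
    apply Rmult_le_compat_l; lra. }
apply cderiv_iff. intros eps He.
exists (Rmin (r - Cmod z) (eps / (K + 1))). split.
{ apply Rmin_pos; [lra|]. apply Rdiv_lt_0_compat; lra. }
intros y Hy.
assert (Hy1 : Cmod (y - z) < r - Cmod z) by (eapply Rlt_le_trans; [exact Hy | apply Rmin_l]).
assert (Hy2 : Cmod (y - z) < eps / (K + 1)) by (eapply Rlt_le_trans; [exact Hy | apply Rmin_r]).
apply Rlt_div_elim in Hy2; [|lra].
eapply Rle_trans; [apply Main|].
- generalize (Cmod_triangle_sub y z); lra.
- assert (Hh := Cmod_ge_0 (y - z)). simpl. nra.
Qed.

Lemma has_series_holomorphic (f : C -> C) (b : nat -> C) : has_series f b -> holomorphic_on unit_disc f.
Proof.
intros H z Hz. destruct (has_series_deriv_coef f b z H Hz) as [l Hl].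
exists l. now apply has_series_cderiv with b.
Qed.

Lemma has_series_C_derive (f : C -> C) (b : nat -> C) : has_series f b -> has_series (C_derive f) (deriv_coef b).
Proof.
intros H z Hz. destruct (has_series_deriv_coef f b z H Hz) as [l Hl].
assert (D := has_series_cderiv f b z l H Hz Hl).
now rewrite (is_C_derive_unique _ _ _ D).
Qed.

Lemma holomorphic_has_series (f : C -> C) : holomorphic_on unit_disc f -> has_series f (taylor_coef f (-1)).
Proof. intros H z Hz. now apply holomorphic_taylor. Qed.

Lemma holomorphic_C_derive (f : C -> C) : holomorphic_on unit_disc f -> holomorphic_on unit_disc (C_derive f).
Proof.
intros H. eapply has_series_holomorphic. apply has_series_C_derive, holomorphic_has_series, H.
Qed.

Lemma unit_disc_0 : unit_disc 0.
Proof. unfold unit_disc. rewrite Cmod_0. lra. Qed.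

Lemma has_series_0 (f : C -> C) (b : nat -> C) : has_series f b -> f (RtoC 0) = b 0%nat.
Proof.
intros H. specialize (H _ unit_disc_0).
assert (E : forall n, csum (fun k => RtoC 0 ^ k * b k)%C n = b 0%nat).
{ intros n. induction n as [|n IH]; [rewrite sum_O; simpl; ring|].
  rewrite csum_S, IH. simpl. ring. }
apply Ceq_minus, Cmod_eq_0. apply Rle_antisym; [|apply Cmod_ge_0].
apply le_epsilon. intros eps He. rewrite Rplus_0_l.
destruct (proj1 (is_pseries_iff _ _ _) H eps He) as [N HN].
specialize (HN N (le_n N)). rewrite E, Cmod_sub_rev in HN. lra.
Qed.

Lemma taylor_derivatives_0 (f : C -> C) (b : nat -> C) : has_series f b ->
  f (RtoC 0) = b 0%nat /\ C_derive f (RtoC 0) = b 1%nat /\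
  C_derive (C_derive f) (RtoC 0) = (2 * b 2%nat)%C /\
  C_derive (C_derive (C_derive f)) (RtoC 0) = (6 * b 3%nat)%C.
Proof.
intros H0. assert (H1 := has_series_C_derive _ _ H0). assert (H2 := has_series_C_derive _ _ H1).
assert (H3 := has_series_C_derive _ _ H2).
rewrite (has_series_0 _ _ H0), (has_series_0 _ _ H1), (has_series_0 _ _ H2), (has_series_0 _ _ H3).
unfold deriv_coef. simpl INR. rewrite !RtoC_plus. repeat split; ring.
Qed.

(** * Coefficients of self-maps of the disc *)

Lemma exp_limit_le (X B : R) : 0 <= X -> 0 < B -> (forall s, s < 0 -> exp s ^ 2 * X <= B) -> X <= B.
Proof.
intros HX HB H. destruct (Rle_lt_dec X B) as [|Hlt]; [assumption|exfalso].
(* If B < X, this s gives exp (2 s) * X >= (1 + 2 s) * X = (X + B) / 2 > B. *)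
set (s := (B - X) / (4 * X)).
assert (Hs : s < 0) by (apply Rlt_div_l; lra).
specialize (H s Hs).
assert (E : exp s ^ 2 = exp (2 * s)) by (replace (2 * s) with (s + s) by ring; rewrite exp_plus; ring).
rewrite E in H.
assert (1 + 2 * s <= exp (2 * s)) by (apply Rlt_le, exp_ineq1; lra).
assert (HsX : s * X = (B - X) / 4) by (unfold s; field; lra).
nra.
Qed.

(* The kernel [z^-2 (1 + sigma z)^2] extracts [c2 + 2 sigma c1 + sigma^2 c0] from [w],
   and its modulus has circle mean [r^-2 (1 + |sigma|^2 r^2)]. *)
Lemma bounded_taylor_ineq (w : C -> C) (sg : C) : holomorphic_on unit_disc w ->
  (forall z, unit_disc z -> unit_disc (w z)) ->
  Cmod (taylor_coef w (-1) 2 + 2 * sg * taylor_coef w (-1) 1 + sg * sg * taylor_coef w (-1) 0) <= 1 + Cmod sg ^ 2.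
Proof.
intros Hw Hb.
assert (HPI : 0 < PI) by apply PI_RGT_0.
apply exp_limit_le; [apply Cmod_ge_0 | generalize (pow2_ge_0 (Cmod sg)); lra |].
intros s Hs. assert (Hes := exp_pos s).
assert (Hes1 : exp s < 1) by (rewrite <- exp_0; now apply exp_increasing).
rewrite (taylor_coef_indep w (-1) s 0), (taylor_coef_indep w (-1) s 1), (taylor_coef_indep w (-1) s 2) by (auto; lra).
assert (I0 := is_CInt_mult_l (sg * sg) _ _ _ _ (is_CInt_taylor w s 0 Hw Hs)).
assert (I1 := is_CInt_mult_l (2 * sg) _ _ _ _ (is_CInt_taylor w s 1 Hw Hs)).
assert (I2 := is_CInt_taylor w s 2 Hw Hs).
assert (I := @is_RInt_plus C_R_NormedModule _ _ _ _ _ _ (@is_RInt_plus C_R_NormedModule _ _ _ _ _ _ I2 I1) I0).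
clear I0 I1 I2.
set (c0 := taylor_coef w s 0) in *. set (c1 := taylor_coef w s 1) in *. set (c2 := taylor_coef w s 2) in *.
set (r := exp s) in *.
assert (HZ : is_CInt (fun t => Ci * Cexp (s, t))%C 0 (2 * PI) (Cexp (s, (2 * PI)%R) - Cexp (s, 0%R))%C).
{ apply (is_CInt_vertical Cexp Cexp); [lra|]. intros t _. split; [apply cderiv_Cexp|].
  eapply cderiv_cont, cderiv_Cexp. }
replace (Cexp (s, (2 * PI)%R) - Cexp (s, 0%R))%C with (RtoC 0) in HZ
  by (rewrite <- (Cexp_periodic s 0), Rplus_0_l; ring).
(* The factor turns Ci * z into 2 sg z, whose real part is the cross term of |1 + sg z|^2; that term
   therefore has mean 0. *)
apply (is_CInt_mult_l (- Ci * sg * 2)) in HZ.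
apply (@is_RInt_fct_extend_fst R_NormedModule R_NormedModule) in HZ.
assert (HC := @is_RInt_const R_NormedModule 0 (2 * PI) (1 + Cmod sg ^ 2 * r ^ 2)).
assert (HG := @is_RInt_plus R_NormedModule _ _ _ _ _ _ HC HZ). clear HC HZ.
apply (@is_RInt_scal R_NormedModule _ _ _ (/ r ^ 2)) in HG.
assert (Hpt : forall z : C, Cmod (1 + sg * z) ^ 2 = 1 + Cmod sg ^ 2 * Cmod z ^ 2 + fst (- Ci * sg * 2 * (Ci * z))%C).
{ intros z. rewrite !Cmod2_alt. destruct z as [z1 z2], sg as [g1 g2]. simpl. ring. }
match type of I with is_CInt ?F _ _ _ => match type of HG with is_RInt ?G _ _ _ =>
  assert (HFG : forall t, 0 <= t <= 2 * PI -> @norm R_AbsRing C_R_NormedModule (F t) <= G t) end end.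
{ intros t _. cbv beta. rewrite <- Cmod_norm.
  match goal with |- Cmod (plus (plus ?X ?Y) ?Z) <= _ => change (plus (plus X Y) Z) with (X + Y + Z)%C end.
  match goal with |- _ <= scal ?X (plus ?Y ?Z) => change (scal X (plus Y Z)) with (X * (Y + Z)) end.
  set (z := Cexp (s, t)).
  assert (Hz : z <> 0%C) by apply Cexp_neq_0.
  assert (Hzr : Cmod z = r) by (unfold z; now rewrite Cmod_Cexp).
  rewrite <- Hzr, <- Hpt.
  match goal with |- Cmod ?X <= _ => replace X with (w z * / z ^ 2 * (1 + sg * z) ^ 2)%C end.
  2:{ simpl. field. exact Hz. }
  rewrite !Cmod_mult, Cmod_inv, !Cmod_pow by now apply Cpow_nz.
  apply Rmult_le_compat_r; [apply pow2_ge_0|].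
  rewrite <- (Rmult_1_l (/ Cmod z ^ 2)) at 2. apply Rmult_le_compat_r.
  - rewrite Hzr. apply Rlt_le, Rinv_0_lt_compat, pow_lt, Hes.
  - apply Rlt_le, Hb. unfold unit_disc. now rewrite Hzr. }
assert (HB := @norm_RInt_le C_R_NormedModule _ _ 0 (2 * PI) _ _ ltac:(lra) HFG I HG).
rewrite <- Cmod_norm in HB.
match type of HB with Cmod (plus (plus ?X ?Y) ?Z) <= _ => change (plus (plus X Y) Z) with (X + Y + Z)%C in HB end.
match type of HB with _ <= scal ?X (plus (scal ?W ?Y) ?Z) => change (scal X (plus (scal W Y) Z)) with (X * (W * Y + Z)) in HB end.
rewrite Cmult_0_r, Rminus_0_r in HB. simpl fst in HB. rewrite Rplus_0_r in HB.
match type of HB with Cmod ?X <= _ =>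
  replace X with (RtoC (2 * PI) * (c2 + 2 * sg * c1 + sg * sg * c0))%C in HB by ring end.
rewrite Cmod_mult, Cmod_R, Rabs_pos_eq in HB by lra.
assert (Hr2 : 0 < r ^ 2 < 1) by (simpl; nra).
set (X := Cmod (c2 + 2 * sg * c1 + sg * sg * c0)) in *.
assert (HX : X <= / r ^ 2 * (1 + Cmod sg ^ 2 * r ^ 2)).
{ apply (Rmult_le_reg_l (2 * PI)); lra. }
apply (Rmult_le_compat_l (r ^ 2)) in HX; [|lra].
rewrite <- Rmult_assoc, Rinv_r, Rmult_1_l in HX by lra.
assert (0 <= Cmod sg ^ 2) by apply pow2_ge_0. nra.
Qed.

(** A suitable sigma of modulus |c1| turns [bounded_taylor_ineq] into |c2| + 2 |c1|^2 <= 1 + |c1|^2.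
    The vanishing of c0 removes the term quadratic in sigma. *)
Theorem schwarz_second_coef (w : C -> C) : holomorphic_on unit_disc w ->
  (forall z, unit_disc z -> unit_disc (w z)) -> w (RtoC 0) = RtoC 0 ->
  Cmod (C_derive (C_derive w) (RtoC 0)) / 2 <= 1 - Cmod (C_derive w (RtoC 0)) ^ 2.
Proof.
intros Hw Hb Hw0.
destruct (taylor_derivatives_0 _ _ (holomorphic_has_series w Hw)) as [E0 [E1 [E2 _]]].
set (c0 := taylor_coef w (-1) 0) in *. set (c1 := taylor_coef w (-1) 1) in *.
set (c2 := taylor_coef w (-1) 2) in *.
rewrite E1, E2, Cmod_mult, Cmod_R, Rabs_pos_eq by lra.
assert (Hu : exists u : C, Cmod u = 1 /\ c2 = (u * RtoC (Cmod c2))%C).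
{ destruct (Ceq_dec c2 0) as [E|E].
  - exists (RtoC 1). split; [apply Cmod_1|]. rewrite E, Cmod_0. ring.
  - assert (Hm : RtoC (Cmod c2) <> RtoC 0).
    { intros E'. apply RtoC_inj in E'. now apply E, Cmod_eq_0. }
    exists (c2 / RtoC (Cmod c2))%C. split.
    + rewrite Cmod_div, Cmod_R, Rabs_pos_eq by (exact Hm || apply Cmod_ge_0).
      field. intros E'. apply Hm. now rewrite E'.
    + field. exact Hm. }
destruct Hu as [u [Hu1 Hu]].
(* With [|u| = 1] and [sigma = u * conj c1] both terms have the same argument. *)
assert (B := bounded_taylor_ineq w (u * Cconj c1) Hw Hb). fold c0 c1 c2 in B.
rewrite <- E0, Hw0 in B.
replace (c2 + 2 * (u * Cconj c1) * c1 + u * Cconj c1 * (u * Cconj c1) * 0)%C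
  with (u * RtoC (Cmod c2 + 2 * Cmod c1 ^ 2))%C in B.
- rewrite !Cmod_mult, Cmod_conj, Hu1, Cmod_R, Rabs_pos_eq in B.
  + lra.
  + generalize (Cmod_ge_0 c2), (pow2_ge_0 (Cmod c1)). lra.
- rewrite Hu at 2. rewrite RtoC_plus, RtoC_mult, Cmod2_conj. ring.
Qed.

(** * Starlike functions subordinate to Phi *)

Lemma is_pseries_C_unique (b : nat -> C) (z l m : C) :
  is_cpseries b z l -> is_cpseries b z m -> l = m.
Proof. apply (@filterlim_locally_unique nat C_AbsRing C_NormedModule eventually _). Qed.

(** Used as g / z, continued to the origin. It removes the common zero from z g' = Phi (w) g, so
    that two differentiations at 0 already reach b3 and the quotient z g' / g is defined at 0. *)
Definition series_tail (f : C -> C) (z : C) : C :=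
  if Ceq_dec z 0 then C_derive f 0 else ((f z - f 0) / z)%C.

Lemma has_series_tail (f : C -> C) (b : nat -> C) : has_series f b ->
  has_series (series_tail f) (fun n => b (S n)).
Proof.
intros H z Hz. apply is_pseries_iff. intros eps He. unfold series_tail.
destruct (Ceq_dec z 0) as [->|E].
- exists 0%nat. intros n _.
  replace (csum (fun k => RtoC 0 ^ k * b (S k))%C n) with (b 1%nat).
  + destruct (taylor_derivatives_0 f b H) as [_ [-> _]].
    replace (b 1%nat - b 1%nat)%C with (RtoC 0) by ring. now rewrite Cmod_0.
  + induction n as [|n IH]; [rewrite sum_O; simpl; ring|]. rewrite csum_S, <- IH. simpl. ring.
- assert (Hm : 0 < Cmod z) by now apply Cmod_gt_0.
  destruct (proj1 (is_pseries_iff _ _ _) (H z Hz) (eps * Cmod z)) as [N HN].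
  { now apply Rmult_lt_0_compat. }
  exists N. intros n Hn. specialize (HN (S n) ltac:(lia)).
  assert (Es : csum (fun k => z ^ k * b k)%C (S n) = (b 0%nat + z * csum (fun k => z ^ k * b (S k))%C n)%C).
  { clear. induction n as [|n IH].
    - rewrite csum_S, !sum_O. simpl. in_C; ring.
    - rewrite csum_S, IH, (csum_S (fun k => z ^ k * b (S k))%C). rewrite !Cpow_S. in_C; ring. }
  rewrite Es in HN.
  apply (Rmult_lt_reg_r (Cmod z)); [exact Hm|]. rewrite <- Cmod_mult.
  rewrite (has_series_0 f b H).
  match goal with |- Cmod ?X < _ =>
    replace X with (b 0%nat + z * csum (fun k => z ^ k * b (S k))%C n - f z)%C by (field; exact E) end.
  exact HN.
Qed.

Lemma cderiv_eq_on_disc (f g : C -> C) (z l m : C) : unit_disc z ->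
  (forall y, unit_disc y -> f y = g y) -> cderiv f z l -> cderiv g z m -> l = m.
Proof.
intros Hz H Hf Hg. apply cderiv_unique with g z; [|exact Hg].
apply cderiv_ext_loc with f (1 - Cmod z); [unfold unit_disc in Hz; lra | | exact Hf].
intros y Hy. apply H. unfold unit_disc. generalize (Cmod_triangle_sub y z); lra.
Qed.

Lemma cderiv_holomorphic (f : C -> C) (z : C) : holomorphic_on unit_disc f -> unit_disc z ->
  cderiv f z (C_derive f z).
Proof. intros Hf Hz. now apply cderiv_C_derive, Hf. Qed.

(* Compares the first two derivatives at the origin of both sides of
   [Phi (w z) * (g z / z) = g' z]. *)
Lemma subordination_coefs (Phi w g : C -> C) (b : nat -> C) :
  holomorphic_on unit_disc Phi -> Phi (RtoC 0) = RtoC 1 ->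
  holomorphic_on unit_disc w -> (forall z, unit_disc z -> unit_disc (w z)) -> w (RtoC 0) = RtoC 0 ->
  has_series g b -> b 0%nat = RtoC 0 -> b 1%nat = RtoC 1 ->
  (forall z, unit_disc z -> (z * C_derive g z = Phi (w z) * g z)%C) ->
  let d1 := C_derive Phi (RtoC 0) in
  let d2 := C_derive (C_derive Phi) (RtoC 0) in
  let w1 := C_derive w (RtoC 0) in
  let w2 := C_derive (C_derive w) (RtoC 0) in
  (b 2%nat = d1 * w1 /\ 4 * b 3%nat = (d2 + 2 * d1 * d1) * w1 * w1 + d1 * w2)%C.
Proof.
intros HPhi HPhi0 Hw Hwd Hw0 Hg Hb0 Hb1 Heq d1 d2 w1 w2.
set (G := series_tail g).
assert (HGs := has_series_tail g b Hg). fold G in HGs.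
assert (HG := has_series_holomorphic _ _ HGs).
destruct (taylor_derivatives_0 _ _ HGs) as [G0 [G1 [G2 _]]].
destruct (taylor_derivatives_0 _ _ Hg) as [g0 [g1 [g2 g3]]].
assert (HPhi1 := holomorphic_C_derive _ HPhi). assert (HG1 := holomorphic_C_derive _ HG).
assert (Hw1 := holomorphic_C_derive _ Hw).
assert (Hg1 := holomorphic_C_derive _ (has_series_holomorphic _ _ Hg)).
assert (Hg2 := holomorphic_C_derive _ Hg1).
assert (E0 : forall z, unit_disc z -> (Phi (w z) * G z)%C = C_derive g z).
{ intros z Hz. unfold G, series_tail. destruct (Ceq_dec z 0) as [->|Ez].
  - rewrite Hw0, HPhi0, g1, Hb1. ring.
  - specialize (Heq z Hz). rewrite g0, Hb0.
    apply (f_equal (fun x => (x / z)%C)) in Heq.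
    replace (z * C_derive g z / z)%C with (C_derive g z) in Heq by (field; exact Ez).
    rewrite Heq. field. exact Ez. }
assert (D : forall F, holomorphic_on unit_disc F -> forall z, unit_disc z ->
  cderiv (fun y => F (w y)) z (C_derive w z * C_derive F (w z))%C).
{ intros F HF z Hz. apply (cderiv_comp F w); [apply cderiv_holomorphic; auto | now apply cderiv_holomorphic]. }
assert (E1 : forall z, unit_disc z ->
  (C_derive w z * C_derive Phi (w z) * G z + Phi (w z) * C_derive G z)%C = C_derive (C_derive g) z).
{ intros z Hz.
  apply (cderiv_eq_on_disc (fun y => Phi (w y) * G y)%C (C_derive g) z); [exact Hz | exact E0 | |].
  - apply (cderiv_mult (fun y => Phi (w y)) G); [now apply D | now apply cderiv_holomorphic].
  - now apply cderiv_holomorphic. }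
assert (E2 : ((C_derive (C_derive w) 0 * C_derive Phi (w 0) +
     C_derive w 0 * (C_derive w 0 * C_derive (C_derive Phi) (w 0))) * G 0 +
    C_derive w 0 * C_derive Phi (w 0) * C_derive G 0 +
    (C_derive w 0 * C_derive Phi (w 0) * C_derive G 0 + Phi (w 0) * C_derive (C_derive G) 0))%C
   = C_derive (C_derive (C_derive g)) (RtoC 0)).
{ apply (cderiv_eq_on_disc (fun z => C_derive w z * C_derive Phi (w z) * G z + Phi (w z) * C_derive G z)%C
    (C_derive (C_derive g)) (RtoC 0)); [apply unit_disc_0 | exact E1 | |].
  - apply cderiv_plus.
    + apply (cderiv_mult (fun z => C_derive w z * C_derive Phi (w z))%C G).
      * apply (cderiv_mult (C_derive w) (fun z => C_derive Phi (w z))).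
        -- apply cderiv_holomorphic; [exact Hw1 | apply unit_disc_0].
        -- apply (D (C_derive Phi)); [exact HPhi1 | apply unit_disc_0].
      * apply cderiv_holomorphic; [exact HG | apply unit_disc_0].
    + apply (cderiv_mult (fun z => Phi (w z)) (C_derive G)).
      * apply (D Phi); [exact HPhi | apply unit_disc_0].
      * apply cderiv_holomorphic; [exact HG1 | apply unit_disc_0].
  - apply cderiv_holomorphic; [exact Hg2 | apply unit_disc_0]. }
specialize (E1 _ unit_disc_0).
rewrite Hw0, HPhi0, G0, G1, Hb1, g2 in E1. fold w1 d1 in E1.
rewrite Hw0, HPhi0, G0, G1, G2, Hb1, g3 in E2. fold w1 w2 d1 d2 in E2.
(* The right-hand sides are g''(0) = 2 b2 and g'''(0) = 6 b3. On the left, since Phi (w 0) = 1, the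
   terms G'(0) = b2 and G''(0) = 2 b3 appear, which leaves b2 and 4 b3. *)
assert (B2 : b 2%nat = (d1 * w1)%C).
{ replace (b 2%nat) with (2 * b 2%nat - b 2%nat)%C by ring. rewrite <- E1. ring. }
split; [exact B2|].
replace (4 * b 3%nat)%C with (6 * b 3%nat - 2 * b 3%nat)%C by ring.
rewrite <- E2, B2. ring.
Qed.

(** Absolute convergence provides a sum at each point of the disc, and [epsilon] names it; outside
    the disc the value is arbitrary. *)
Lemma has_series_dominated (f : C -> C) (b c : nat -> C) : has_series f b ->
  (forall n, Cmod (c n) <= Cmod (b n)) -> exists F, has_series F c.
Proof.
intros H Hle.
assert (Hex : forall z, unit_disc z -> exists l, is_cpseries c z l).
{ intros z Hz.
  assert (Hm : Rabs (Cmod z) < 1) by (rewrite Rabs_pos_eq; [exact Hz | apply Cmod_ge_0]).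
  assert (L := has_series_CV_radius f b (Cmod z) H Hm). apply CV_disk_inside in L.
  apply (@ex_series_le C_AbsRing C_CompleteNormedModule) with (2 := L).
  intros n. change (Cmod (@pow_n C_Ring z n * c n) <= Rabs (Cmod (b n) * Cmod z ^ n)).
  rewrite Cpow_pow_n, Cmod_mult, Cmod_pow, Rabs_pos_eq.
  - rewrite Rmult_comm. apply Rmult_le_compat_r; [apply pow_le, Cmod_ge_0 | apply Hle].
  - apply Rmult_le_pos; [apply Cmod_ge_0 | apply pow_le, Cmod_ge_0]. }
exists (fun z => epsilon (inhabits (RtoC 0)) (is_cpseries c z)).
intros z Hz. apply epsilon_spec, Hex, Hz.
Qed.

(** On power series z d/dz multiplies the n-th coefficient by n, so dividing by n inverts it once
    the constant term is removed. No path integral is involved. *)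
Lemma log_primitive (f : C -> C) : holomorphic_on unit_disc f ->
  exists L, holomorphic_on unit_disc L /\ L (RtoC 0) = RtoC 0 /\
    forall z, unit_disc z -> (z * C_derive L z = f z - f 0)%C.
Proof.
intros Hf. set (b := taylor_coef f (-1)). assert (Hs : has_series f b) by now apply holomorphic_has_series.
set (c := fun n => match n with O => RtoC 0 | S _ => (b n / RtoC (INR n))%C end).
assert (Hn : forall n, RtoC (INR (S n)) <> RtoC 0).
{ intros n E. apply RtoC_inj in E. now apply (not_0_INR (S n)). }
destruct (has_series_dominated f b c Hs) as [L HL].
{ intros [|n]; unfold c; [rewrite Cmod_0; apply Cmod_ge_0|].
  rewrite Cmod_div, Cmod_R, Rabs_pos_eq by (apply Hn || apply pos_INR).
  assert (1 <= INR (S n)) by (rewrite S_INR; generalize (pos_INR n); lra).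
  apply Rle_div_l; [lra|]. generalize (Cmod_ge_0 (b (S n))); nra. }
exists L. split; [now apply has_series_holomorphic with c|].
split; [apply (has_series_0 L c HL)|].
intros z Hz.
assert (E : C_derive L z = series_tail f z).
{ apply (is_pseries_C_unique (fun n => b (S n)) z); [|now apply has_series_tail].
  assert (HD := has_series_C_derive L c HL z Hz).
  apply is_pseries_iff. intros eps He. destruct (proj1 (is_pseries_iff _ _ _) HD eps He) as [N HN].
  exists N. intros n Hn'. rewrite (sum_n_ext _ (fun k => (z ^ k * deriv_coef c k)%C)); [now apply HN|].
  intros k. unfold deriv_coef, c. in_C. field. apply Hn. }
rewrite E. unfold series_tail. destruct (Ceq_dec z 0) as [->|Ez]; [ring | field; exact Ez].
Qed.

(** Through this default value a zero of g' shows up as a zero of [over_derivative g], which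
    [class_M] forbids off the origin. *)
Lemma Cdiv_0_r (x : C) : (x / 0)%C = RtoC 0.
Proof. unfold Cdiv, Cinv. apply injective_projections; simpl; unfold Rdiv; ring. Qed.

Lemma det_bound_eq (d1 d2 : R) : 0 < d1 ->
  d1 ^ 2 / 4 * (1 / 2 * (d2 / d1) + d1) ^ 2 + d1 ^ 2 = ((d2 + 2 * d1 ^ 2) / 4) ^ 2 + d1 ^ 2.
Proof. intros H. field. lra. Qed.

(** The function w is the inverse of Phi applied to g' / (g / z). The denominator has no zero: it is
    1 at the origin, and elsewhere a zero of g would be a zero of g / g'. *)
Lemma class_M_subordination (Phi g : C -> C) (b : nat -> C) :
  biholomorphic_onto_image unit_disc Phi -> Phi (RtoC 0) = RtoC 1 ->
  normalized_expansion g b -> class_M Phi (over_derivative g) ->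
  exists w, holomorphic_on unit_disc w /\ (forall z, unit_disc z -> unit_disc (w z)) /\
    w (RtoC 0) = RtoC 0 /\
    forall z, unit_disc z -> (z * C_derive g z = Phi (w z) * g z)%C.
Proof.
intros [HPhi [_ [h [Hh Hinv]]]] HPhi0 [_ [Hb0 [Hb1 Hs]]] [_ [_ [_ [Hnz Him]]]].
change (has_series g b) in Hs.
destruct (taylor_derivatives_0 _ _ Hs) as [g0 [g1 _]]. rewrite Hb0 in g0. rewrite Hb1 in g1.
assert (HG := has_series_holomorphic _ _ (has_series_tail g b Hs)).
assert (Hg1 := holomorphic_C_derive _ (has_series_holomorphic _ _ Hs)).
assert (Hgz : forall z, unit_disc z -> z <> RtoC 0 -> g z <> RtoC 0 /\ C_derive g z <> RtoC 0).
{ intros z Hz Ez. specialize (Hnz z Hz Ez). unfold over_derivative in Hnz.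
  split; intros E; apply Hnz; rewrite E; [unfold Cdiv; ring | apply Cdiv_0_r]. }
assert (HGz : forall z, unit_disc z -> series_tail g z <> RtoC 0).
{ intros z Hz. unfold series_tail. destruct (Ceq_dec z 0) as [->|Ez].
  - rewrite g1. apply C1_nz.
  - destruct (Hgz z Hz Ez) as [A _]. rewrite g0. intros E. apply A.
    replace (g z) with (z * ((g z - 0) / z))%C by (field; exact Ez). rewrite E. ring. }
(* A quotient of holomorphic functions that agrees with [id_quotient] on the disc, so that
   differentiability at 0 needs no separate argument. *)
set (q := fun z => (C_derive g z / series_tail g z)%C).
assert (Hq : forall z, unit_disc z -> id_quotient (over_derivative g) z = q z).
{ intros z Hz. unfold id_quotient, q, series_tail, over_derivative.
  destruct (Ceq_dec z 0) as [->|Ez].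
  - rewrite g1. field.
  - destruct (Hgz z Hz Ez) as [A B]. rewrite g0. field. repeat split; auto. }
assert (Hpre : forall z, unit_disc z -> exists y, unit_disc y /\ Phi y = q z).
{ intros z Hz. rewrite <- (Hq z Hz). apply Him, Hz. }
exists (fun z => h (q z)). repeat split.
- intros z Hz. apply (cdiff_comp h q).
  + apply Hh. destruct (Hpre z Hz) as [y Hy]. now exists y.
  + eexists. apply cderiv_div; [now apply cderiv_holomorphic | now apply cderiv_holomorphic | now apply HGz].
- intros z Hz. destruct (Hpre z Hz) as [y [Hy <-]]. now rewrite Hinv.
- unfold q. unfold series_tail. destruct (Ceq_dec 0 0) as [_|E]; [|easy].
  rewrite g1. replace (RtoC 1 / RtoC 1)%C with (Phi (RtoC 0)) by (rewrite HPhi0; field).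
  apply Hinv, unit_disc_0.
- intros z Hz. destruct (Hpre z Hz) as [y [Hy Ey]]. rewrite <- Ey, Hinv, Ey by exact Hy.
  unfold q, series_tail. destruct (Ceq_dec z 0) as [->|Ez]; [rewrite g0; ring|].
  rewrite g0. field. split; [exact Ez | now apply Hgz].
Qed.

(** * The extremal function and the sharp bound *)

Lemma Re_pos_neq_0 (z : C) : 0 < Re z -> z <> RtoC 0.
Proof. intros H E. rewrite E in H. simpl in H. lra. Qed.

Lemma unit_disc_Ci_mult (z : C) : unit_disc z -> unit_disc (Ci * z).
Proof. unfold unit_disc. now rewrite Cmod_mult, Cmod_Ci, Rmult_1_l. Qed.

Lemma cderiv_Ci_mult (z : C) : cderiv (fun y => Ci * y)%C z Ci.
Proof.
eapply cderiv_eq.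
- apply (cderiv_mult (fun _ => Ci) (fun y => y)); [apply cderiv_const | apply cderiv_id].
- ring.
Qed.

(** Positivity of Re Phi keeps g' = exp (L) * Phi (i z) away from 0, so g / g' is holomorphic; as
    exp has no zeros, g vanishes only at the origin and z g' / g is exactly Phi (i z). *)
Lemma extremal_function (Phi : C -> C) :
  holomorphic_on unit_disc Phi -> Phi (RtoC 0) = RtoC 1 -> (forall z, unit_disc z -> 0 < Re (Phi z)) ->
  exists g b, normalized_expansion g b /\ class_M Phi (over_derivative g) /\
    forall z, unit_disc z -> (z * C_derive g z = Phi (Ci * z) * g z)%C.
Proof.
intros HPhi HPhi0 HRe.
set (F := fun z => Phi (Ci * z)%C).
assert (HF : holomorphic_on unit_disc F).
{ intros z Hz. apply (cdiff_comp Phi (fun y => Ci * y)%C).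
  - now apply HPhi, unit_disc_Ci_mult.
  - eexists. apply cderiv_Ci_mult. }
assert (HF0 : F (RtoC 0) = RtoC 1) by (unfold F; rewrite Cmult_0_r; exact HPhi0).
assert (HFz : forall z, unit_disc z -> F z <> RtoC 0).
{ intros z Hz. now apply Re_pos_neq_0, HRe, unit_disc_Ci_mult. }
destruct (log_primitive F HF) as [L [HL [HL0 HLz]]].
set (g := fun z => (z * Cexp (L z))%C).
assert (Hgd : forall z, unit_disc z -> cderiv g z (Cexp (L z) * F z)%C).
{ intros z Hz. eapply cderiv_eq.
  - apply (cderiv_mult (fun y => y) (fun y => Cexp (L y))); [apply cderiv_id|].
    apply (cderiv_comp Cexp L); [apply cderiv_Cexp | now apply cderiv_holomorphic].
  - rewrite Cmult_assoc, HLz, HF0 by exact Hz. ring. }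
assert (Hg : holomorphic_on unit_disc g) by (intros z Hz; eexists; now apply Hgd).
assert (Hg1 : forall z, unit_disc z -> C_derive g z = (Cexp (L z) * F z)%C)
  by (intros z Hz; now apply is_C_derive_unique, Hgd).
assert (Hg1z : forall z, unit_disc z -> C_derive g z <> RtoC 0).
{ intros z Hz. rewrite Hg1 by exact Hz. apply Cmult_neq_0; [apply Cexp_neq_0 | now apply HFz]. }
assert (g0 : g (RtoC 0) = RtoC 0) by (unfold g; ring).
assert (g1 : C_derive g (RtoC 0) = RtoC 1).
{ rewrite Hg1, HL0, Cexp_0, HF0 by apply unit_disc_0. ring. }
assert (Hs := holomorphic_has_series g Hg).
destruct (taylor_derivatives_0 _ _ Hs) as [b0 [b1 _]].
assert (Hdd := holomorphic_C_derive g Hg).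
exists g, (taylor_coef g (-1)). split; [|split].
- repeat split; [exact Hg | now rewrite <- b0 | now rewrite <- b1 | exact Hs].
- repeat split.
  + intros z Hz. eexists. unfold over_derivative.
    apply cderiv_div; [now apply cderiv_holomorphic | now apply cderiv_holomorphic | now apply Hg1z].
  + unfold over_derivative. rewrite g0. unfold Cdiv. ring.
  + apply is_C_derive_unique. unfold over_derivative. eapply cderiv_eq.
    * apply (cderiv_div g (C_derive g));
        [exact (cderiv_holomorphic g _ Hg unit_disc_0)
        | exact (cderiv_holomorphic (C_derive g) _ Hdd unit_disc_0)
        | exact (Hg1z _ unit_disc_0)].
    * rewrite g0, g1. field.
  + intros z Hz Ez. unfold over_derivative, Cdiv. apply Cmult_neq_0.
    * unfold g. apply Cmult_neq_0; [exact Ez | apply Cexp_neq_0].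
    * intros E. apply C1_nz. rewrite <- (Cinv_r (C_derive g z)) by now apply Hg1z. rewrite E. ring.
  + intros z Hz. exists (Ci * z)%C. split; [now apply unit_disc_Ci_mult|].
    unfold id_quotient. destruct (Ceq_dec z 0) as [->|Ez]; [exact HF0|].
    unfold over_derivative. rewrite Hg1 by exact Hz. unfold g. change (Phi (Ci * z)%C) with (F z).
    field. repeat split; [now apply HFz | apply Cexp_neq_0 | exact Ez].
- intros z Hz. rewrite Hg1 by exact Hz. unfold g. change (Phi (Ci * z)%C) with (F z). ring.
Qed.

Theorem theorem2p1 :
  forall (Phi : C -> C) (d1 d2 : R),
    biholomorphic_onto_image unit_disc Phi ->
    Phi 0%C = 1%C ->
    (forall z : C, unit_disc z -> (0 < Re (Phi z))%R) ->
    C_derive Phi 0%C = RtoC d1 ->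
    (0 < d1)%R ->
    C_derive (C_derive Phi) 0%C = RtoC d2 ->
    (Rabs (d2 + 2 * d1 ^ 2) >= 2 * d1)%R ->
    (2 * d1 > 0)%R ->
    (forall (g : C -> C) (b : nat -> C),
       normalized_expansion g b ->
       class_M Phi (over_derivative g) ->
       (Cmod (detT22 b)
          <= d1 ^ 2 / 4 * (1 / 2 * (d2 / d1) + d1) ^ 2 + d1 ^ 2)%R) /\
    (exists (g : C -> C) (b : nat -> C),
       normalized_expansion g b /\
       class_M Phi (over_derivative g) /\
       Cmod (detT22 b)
         = (d1 ^ 2 / 4 * (1 / 2 * (d2 / d1) + d1) ^ 2 + d1 ^ 2)%R).
Proof.
intros Phi d1 d2 HPhi HPhi0 HRe Hd1 Hd1p Hd2 HE _.
assert (HPhol := proj1 HPhi).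
rewrite (det_bound_eq d1 d2 Hd1p).
set (E := d2 + 2 * d1 ^ 2) in *.
assert (HEc : (RtoC d2 + 2 * RtoC d1 * RtoC d1)%C = RtoC E).
{ unfold E. rewrite RtoC_plus, RtoC_mult, RtoC_pow. ring. }
split.
- intros g b Hg HM.
  destruct (class_M_subordination Phi g b HPhi HPhi0 Hg HM) as [w [Hw [Hwd [Hw0 Heq]]]].
  destruct Hg as [_ [Hb0 [Hb1 Hs]]].
  destruct (subordination_coefs Phi w g b HPhol HPhi0 Hw Hwd Hw0 Hs Hb0 Hb1 Heq) as [B2 B3].
  assert (HS := schwarz_second_coef w Hw Hwd Hw0).
  rewrite Hd1 in B2. rewrite Hd1, Hd2, HEc in B3.
  set (w1 := C_derive w _) in *. set (w2 := C_derive (C_derive w) _) in *.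
  assert (Ha := Cmod_ge_0 w1). assert (Hc := Cmod_ge_0 w2).
  assert (M2 : Cmod (b 2%nat) = d1 * Cmod w1).
  { rewrite B2, Cmod_mult, Cmod_R, Rabs_pos_eq; lra. }
  assert (M3 : 4 * Cmod (b 3%nat) <= Rabs E).
  { replace (4 * Cmod (b 3%nat)) with (Cmod (4 * b 3%nat)).
    - rewrite B3. eapply Rle_trans; [apply Cmod_triangle|].
      (* By [HS], d1 |w2| <= 2 d1 (1 - |w1|^2), and [HE] replaces 2 d1 by |E|; the two contributions
         then add up to |E|. *)
      rewrite !Cmod_mult, !Cmod_R, (Rabs_pos_eq d1) by lra. nra.
    - rewrite Cmod_mult, Cmod_R, Rabs_pos_eq; lra. }
  unfold detT22, det2, Cminus. eapply Rle_trans; [apply Cmod_triangle|].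
  rewrite Cmod_opp, !Cmod_mult, M2.
  assert (H3 := Cmod_ge_0 (b 3%nat)).
  assert (A3 : Cmod (b 3%nat) * Cmod (b 3%nat) <= (E / 4) ^ 2).
  { replace ((E / 4) ^ 2) with ((Rabs E / 4) * (Rabs E / 4)).
    - apply Rmult_le_compat; lra.
    - rewrite <- (pow2_abs (E / 4)). unfold Rdiv. rewrite Rabs_mult, (Rabs_pos_eq (/ 4)) by lra. ring. }
  (* The bound |w1| <= 1 is contained in [HS], whose left-hand side is non-negative. *)
  assert (A2 : d1 * Cmod w1 * (d1 * Cmod w1) <= d1 ^ 2).
  { replace (d1 * Cmod w1 * (d1 * Cmod w1)) with (d1 ^ 2 * Cmod w1 ^ 2) by ring.
    rewrite <- (Rmult_1_r (d1 ^ 2)) at 2. apply Rmult_le_compat_l; [apply pow2_ge_0 | lra]. }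
  lra.
- destruct (extremal_function Phi HPhol HPhi0 HRe) as [g [b [Hg [HM Heq]]]].
  exists g, b. split; [exact Hg|]. split; [exact HM|].
  destruct Hg as [_ [Hb0 [Hb1 Hs]]].
  assert (Hw : holomorphic_on unit_disc (fun z => Ci * z)%C) by (intros z _; eexists; apply cderiv_Ci_mult).
  destruct (subordination_coefs Phi (fun z => Ci * z)%C g b HPhol HPhi0 Hw unit_disc_Ci_mult
    (Cmult_0_r Ci) Hs Hb0 Hb1 Heq) as [B2 B3].
  assert (W1 : forall z, C_derive (fun z => Ci * z)%C z = Ci)
    by (intros z; apply is_C_derive_unique, cderiv_Ci_mult).
  assert (W2 : C_derive (C_derive (fun z => Ci * z)%C) (RtoC 0) = RtoC 0).
  { apply is_C_derive_unique. apply cderiv_ext_loc with (fun _ => Ci) 1; [lra | | apply cderiv_const].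
    intros y _. now rewrite W1. }
  rewrite Hd1, W1 in B2. rewrite Hd1, Hd2, HEc, W1, W2 in B3.
  assert (HCi : (Ci * Ci)%C = (- RtoC 1)%C) by (apply injective_projections; simpl; ring).
  (* For w = i z the second derivative of w vanishes, and w1^2 = -1 produces the sign. *)
  assert (B3' : b 3%nat = (- RtoC (E / 4))%C).
  { replace (b 3%nat) with (/ RtoC 4 * (4 * b 3%nat))%C
      by (field; intros X; apply RtoC_inj in X; lra).
    rewrite B3, <- (Cmult_assoc _ Ci Ci), HCi. unfold Rdiv. rewrite RtoC_mult, RtoC_inv by lra. ring. }
  replace (detT22 b) with (- RtoC ((E / 4) ^ 2 + d1 ^ 2))%C.
  + rewrite Cmod_opp, Cmod_R, Rabs_pos_eq; [reflexivity|].
    generalize (pow2_ge_0 (E / 4)), (pow2_ge_0 d1); lra.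
  + unfold detT22, det2. rewrite B2, B3', RtoC_plus, !RtoC_pow.
    replace (RtoC d1 * Ci * (RtoC d1 * Ci))%C with (RtoC d1 * RtoC d1 * (Ci * Ci))%C by ring.
    rewrite HCi. ring.
Qed.
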